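(* Suppose $\Pi_{PIR}=(\mathsf{Query},\mathsf{Answer},\mathsf{Decode})$ is a computationally private PIR scheme. Then the PILLAR-Tree protocol (described in the context, with its PIR queries made with $\Pi_{PIR}$) is secure against a semi-honest server.
   Context: **PIR.** A single-server PIR (private information retrieval) scheme $\Pi_{PIR}=(\mathsf{Query},\mathsf{Answer},\mathsf{Decode})$ over a database $DB$ of $n$ records is *computationally private* if, with $\lambda$ the security parameter: (1) correctness: for any index $i\in[n]$, $\Pr[\mathsf{Decode}(\mathsf{Answer}(DB,\mathsf{Query}(i)))=DB[i]]\ge 1-\mathsf{negl}(\lambda)$; (2) privacy: for all indices $i,j\in[n]$ and all PPT distinguishers $\mathcal D$, $|\Pr[\mathcal D(\mathsf{Query}(i))=1]-\Pr[\mathcal D(\mathsf{Query}(j))=1]|\le\mathsf{negl}(\lambda)$. **Security.** A semi-honest server follows the protocol but tries to learn about the client's query. Security is defined via the standard simulation paradigm: there is a PPT simulator that, given only the public parameters (including $\lambda$), produces an output computationally indistinguishable from the server's view in a real execution, for every client query $Q$ (of the fixed length $q^\star$). The server's view during retrieval consists of the PIR queries it receives from the client in the three stages below. **Public parameters.** A corpus $\mathcal C=\{D_1,\dots,D_N\}$ of documents; the set $\mathcal V$ of all unique terms in the documents of $\mathcal C$; an embedding function giving each document $D$ a vector $e_D\in\mathbb R^d$ and the query a vector $e_Q\in\mathbb R^d$; a lexical (BM25) score of a term with respect to a document; leaf block size $B$; sub-block size $s$; tree branching factor $r$; beam width $W$; number $k_s$ of sub-blocks retrieved; maximum number $q^\star$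 of unique query terms; $m$ public hash functions $h_1,\dots,h_m$ applied to pairs (term, node), with values used as row indices of the table being queried; cuckoo hash table load factor $\alpha$; output size $k$. The client's input is a query $Q=\{w_1,\dots,w_{q^\star}\}$ (padded or truncated to the fixed size $q^\star$). **Tree.** The documents are grouped into leaf blocks of $B$ documents, which are the leaves of an $r$-ary tree of height $\mathcal H=1+\lceil\log_r(N/B)\rceil$; levels run from $1$ (root) to $\mathcal H$ (leaves). An internal node represents the super-block of all documents in the leaf blocks of its subtree. $\mathcal T_\ell$ is the set of nodes at level $\ell$, and $\mathsf{id}(\cdot)$ denotes the index of a block or sub-block. For a block $\mathcal B$ and a term $w$, $\sigma_w(\mathcal B)$ is the largest score between $w$ and any document in $\mathcal B$. Each leaf block is divided into sub-blocks $\mathcal{SB}_1,\dots,\mathcal{SB}_{\lceil B/s\rceil}$ of size $s$. **PILLAR-Tree protocol.** *Preprocessing (server).* For each level $\ell\in[\mathcal H]$ let $N_\ell$ be the number of pairs $(w,\mathcal B)\in\mathcal V\times\mathcal T_\ell$ with $\sigma_w(\mathcal B)\ne0$; the server initializes a database $DB_{tree,\ell}$ of $\lceil N_\ell/\alpha\rceil$ rows, and an empty database $DB_{vector}$ of $\lceil N/s\rceil$ rows. For each node $\mathcal B$ at level $\ell$ with $1\le\ell\le\mathcal H-1$, with children $\mathcal B_1,\dots,\mathcal B_r$, and each word $w$ appearing in documents of $\mathcal B$, it adds the tuple $(w,\mathsf{id}(\mathcal B),\sigma_w(\mathcal B_1),\dots,\sigma_w(\mathcal B_r))$ to $DB_{tree,\ell}$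 by cuckoo hashing on input $(w,\mathsf{id}(\mathcal B))$ with $h_1,\dots,h_m$ (i.e. the tuple is placed in one of the rows $h_1(w,\mathsf{id}(\mathcal B)),\dots,h_m(w,\mathsf{id}(\mathcal B))$, at most one tuple per row). For each leaf block $\mathcal B$ and each word $w$ appearing in it, it stores $(w,\mathsf{id}(\mathcal B),\sigma_w(\mathcal{SB}_1),\dots,\sigma_w(\mathcal{SB}_{\lceil B/s\rceil}))$ in $DB_{tree,\mathcal H}$ by cuckoo hashing on $(w,\mathsf{id}(\mathcal B))$ with $h_1,\dots,h_m$. For each sub-block $\mathcal{SB}$ at position $p=\mathsf{id}(\mathcal{SB})$, it stores in row $p$ of $DB_{vector}$ the embeddings $(e_{D_1},\dots,e_{D_s})$ of the $s$ documents of $\mathcal{SB}$. *Stage 1 (tree traversal).* The client sets $F_1=\{\text{root}\}$. For each level $\ell=1,\dots,\mathcal H-1$: for each $w\in Q$ the client retrieves by PIR the $m|F_\ell|$ rows $h_a(w,\mathsf{id}(\mathcal B))$, $a\in[m]$, $\mathcal B\in F_\ell$, of $DB_{tree,\ell}$. For each $\mathcal B\in F_\ell$, if no retrieved row has first two fields $w$ and $\mathsf{id}(\mathcal B)$, it sets $\sigma_w(\mathcal B_j)=0$ for every child $\mathcal B_j$ of $\mathcal B$, $j\in[r]$; otherwise it sets $\sigma_w(\mathcal B_j)$ to the $(j+2)$-th field of the matching row. It computes $\sigma_Q(\mathcal B')=\sum_{w\in Q}\sigma_w(\mathcal B')$ for every child $\mathcal B'$ of every node in $F_\ell$, ranks these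 children by $\sigma_Q$ locally, and lets $F_{\ell+1}$ be the top $\min\{W,|\mathcal T_{\ell+1}|\}$ of them. The result is $F_{\mathcal H}$, the top $W$ leaf blocks. *Stage 2 (sub-block retrieval).* For each $w\in Q$ the client retrieves by PIR the $mW$ rows $h_a(w,\mathsf{id}(\mathcal B))$, $a\in[m]$, $\mathcal B\in F_{\mathcal H}$, of $DB_{tree,\mathcal H}$, and, as in Stage 1, obtains $\sigma_w$ of the sub-blocks of each $\mathcal B\in F_{\mathcal H}$ (all $0$ if there is no matching row). It computes $\sigma_Q(\mathcal{SB})=\sum_{w\in Q}\sigma_w(\mathcal{SB})$ for all sub-blocks of these leaf blocks and locally selects the top $k_s$ sub-blocks. *Stage 3 (dense retrieval and ranking).* The client retrieves by PIR the $k_s$ rows of $DB_{vector}$ indexed by the selected sub-blocks, locally computes $\cos(e_Q,e_D)$ for the $k_s\cdot s$ documents $D$ whose embeddings were retrieved, and outputs the top $k$ documents with highest similarity. *)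

(* Defs.v *)
From HB Require Import structures.
From mathcomp Require Import all_boot all_order all_algebra.
From mathcomp Require Import reals.

Set Implicit Arguments.
Unset Strict Implicit.
Unset Printing Implicit Defensive.

Import Order.TTheory GRing.Theory Num.Theory.

Local Open Scope ring_scope.

(** * Randomised experiments: finite trees of fair coin flips *)

Inductive dist (A : Type) : Type :=
| Ret of A
| Flip of (bool -> dist A).

Fixpoint bind (A B : Type) (d : dist A) (f : A -> dist B) : dist B :=
  match d with
  | Ret a => f a
  | Flip g => Flip (fun b => bind (g b) f)
  end.

Fixpoint Pr (R : realType) (A : Type) (E : A -> bool) (d : dist A) : R :=
  match d with
  | Ret a => (E a)%:R
  | Flip g => (Pr R E (g true) + Pr R E (g false)) / 2
  end.

Fixpoint surely (A : Type) (E : A -> bool) (d : dist A) : Prop :=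
  match d with
  | Ret a => E a
  | Flip g => forall b, surely E (g b)
  end.

Definition negligible (R : realType) (nu : nat -> R) : Prop :=
  forall c : nat, exists n0 : nat,
    forall n : nat, (n0 < n)%N -> `|nu n| < (n%:R ^+ c)^-1.

(** * Probabilistic polynomial time *)

(* The machine model is a probabilistic machine with finitely many stacks of
   bits (a tape is a pair of stacks), programmed in structured form.  Every
   instruction inspects or changes the top of one stack only, and the
   continuation has depth bounded by the nesting of the program, so a step is a
   constant amount of work of a probabilistic multi-tape Turing machine. *)

Definition bits := seq bool.

Inductive instr : Type :=
| Push of nat & bool
| Pop of nat
| Toss of nat
| Case of nat & seq instr & seq instr & seq instr
| While of nat & seq instr.

Definition store := nat -> bits.

Definition update (st : store) (x : nat) (s : bits) : store :=
  fun y => if y == x then s else st y.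

(* [Case x p0 p1 p2] peeks at stack [x]: [p0] if it is empty, [p1] if its top is
   [false], [p2] if its top is [true].  [While x p] loops until [x] is empty. *)
Definition step (c : seq instr * store) : dist (seq instr * store) :=
  let: (k, st) := c in
  match k with
  | [::] => Ret c
  | Push x b :: k' => Ret (k', update st x (b :: st x))
  | Pop x :: k' => Ret (k', update st x (behead (st x)))
  | Toss x :: k' => Flip (fun b => Ret (k', update st x (b :: st x)))
  | Case x p0 p1 p2 :: k' =>
      Ret (match st x with
           | [::] => p0
           | false :: _ => p1
           | true :: _ => p2
           end ++ k', st)
  | While x p :: k' =>
      Ret (if st x is [::] then k' else p ++ While x p :: k', st)
  end.

Fixpoint steps (t : nat) (c : seq instr * store) : dist (seq instr * store) :=
  if t is t'.+1 then bind (step c) (steps t') else Ret c.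

Definition initial (code : seq instr) (inputs : seq bits) : seq instr * store :=
  (code, nth [::] inputs).

Definition halted (c : seq instr * store) : bool := nilp c.1.

(* Every polynomial is dominated by some [n ^ k + k]. *)
Definition time_bound (k : nat) (inputs : seq bits) : nat :=
  (sumn (map size inputs) ^ k + k)%N.

Record ppt : Type := PPT {
  ppt_code : seq instr;
  ppt_deg : nat;
  _ : forall inputs : seq bits,
      surely halted (steps (time_bound ppt_deg inputs) (initial ppt_code inputs))
}.

(* The contents of the stacks when [M] has halted; since a halted configuration
   is not changed by [step], this does not depend on the choice of [ppt_deg]. *)
Definition exec (M : ppt) (inputs : seq bits) : dist store :=
  bind (steps (time_bound (ppt_deg M) inputs) (initial (ppt_code M) inputs))
       (fun c => Ret c.2).

Definition output (M : ppt) (inputs : seq bits) : dist bits :=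
  bind (exec M inputs) (fun st => Ret (st 0%N)).

Definition unary (n : nat) : bits := nseq n true.

(* [Pr[D(1^lam, x) = 1]] for [x] drawn from [d]. *)
Definition Pr_accept (R : realType) (D : ppt) (lam : nat) (d : dist bits) : R :=
  Pr R (fun o => o == [:: true]) (bind d (fun x => output D [:: unary lam; x])).

(** * Single-server PIR *)

(* A database is a list of [n] records of [L] bits; records are numbered from 0.
   The numbers are given in unary, so the algorithms may run in time polynomial
   in [lam], [n] and [L].  Besides the message for the server, [Query] leaves in
   stack 1 a state that the client keeps for [Decode]. *)
Record pir_scheme : Type := PIR {
  pir_Query : ppt;
  pir_Answer : ppt;
  pir_Decode : ppt
}.

Definition Query (Pi : pir_scheme) (lam n L i : nat) : dist (bits * bits) :=
  bind (exec (pir_Query Pi) [:: unary lam; unary n; unary L; unary i])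
       (fun st => Ret (st 0%N, st 1%N)).

Definition Answer (Pi : pir_scheme) (lam L : nat) (DB : seq bits) (q : bits) :
    dist bits :=
  output (pir_Answer Pi)
         [:: unary lam; unary (size DB); unary L; flatten DB; q].

Definition Decode (Pi : pir_scheme) (lam : nat) (state ans : bits) : dist bits :=
  output (pir_Decode Pi) [:: unary lam; state; ans].

(* One retrieval: the message received by the server and the record decoded by
   the client. *)
Definition retrieve (Pi : pir_scheme) (lam L : nat) (DB : seq bits) (i : nat) :
    dist (bits * bits) :=
  bind (Query Pi lam (size DB) L i) (fun qs =>
  bind (Answer Pi lam L DB qs.1) (fun a =>
  bind (Decode Pi lam qs.2 a) (fun x =>
  Ret (qs.1, x)))).

Definition pir_correct (R : realType) (Pi : pir_scheme) : Prop :=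
  forall (L : nat) (DB : seq bits) (i : nat),
    all (fun x => size x == L) DB -> (i < size DB)%N ->
    exists nu : nat -> R, negligible nu /\
      forall lam : nat,
        Pr R (fun o => o.2 == nth [::] DB i) (retrieve Pi lam L DB i)
          >= 1 - nu lam.

Definition query_message (Pi : pir_scheme) (lam n L i : nat) : dist bits :=
  bind (Query Pi lam n L i) (fun qs => Ret qs.1).

Definition pir_private (R : realType) (Pi : pir_scheme) : Prop :=
  forall (n L i j : nat) (D : ppt),
    (i < n)%N -> (j < n)%N ->
    exists nu : nat -> R, negligible nu /\
      forall lam : nat,
        `| Pr_accept R D lam (query_message Pi lam n L i)
           - Pr_accept R D lam (query_message Pi lam n L j) | <= nu lam.

Definition computationally_private (R : realType) (Pi : pir_scheme) : Prop :=
  pir_correct R Pi /\ pir_private R Pi.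

(** * Public parameters *)

(* Fixed-length binary representation of the rows of a database. *)
Record codec (T : Type) : Type := Codec {
  width : nat;
  enc : T -> bits;
  dec : bits -> T
}.

Definition lossless (T : eqType) (c : codec T) (rows : seq T) : Prop :=
  forall x, x \in rows -> size (enc c x) = width c /\ dec c (enc c x) = x.

(* A row of a lexical table: empty, or (word, id of the node, scores). *)
Definition lex_row (R : realType) (term : eqType) : Type :=
  option (term * nat * seq R).

(* Documents are numbered by ['I_ndocs]; the nodes of each level, and the
   sub-blocks, are numbered from 0.  [children l b] lists the children (at level
   [l.+1]) of node [b] of level [l]; [subs b] lists the positions of the
   sub-blocks of leaf block [b]; [subblock p] lists the documents of the
   sub-block at position [p].  [hash a w l b] is the value of the [a]-th hash
   function on word [w] and node [b] of level [l].  [score w D] is the lexical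
   score; it may depend on the whole corpus, as BM25 does.  [nsub] is the number
   of sub-blocks retrieved at the end, [load] the load factor of the tables and
   [nterms] the fixed length of the queries. *)
Record params (R : realType) : Type := Params {
  term : eqType;
  ndocs : nat;
  corpus : 'I_ndocs -> seq term;
  dim : nat;
  emb_doc : 'I_ndocs -> 'rV[R]_dim;
  score : term -> 'I_ndocs -> R;
  leaf_size : nat;
  sub_size : nat;
  arity : nat;
  beam : nat;
  nsub : nat;
  nterms : nat;
  nhash : nat;
  hash : 'I_nhash -> term -> nat -> nat -> nat;
  load : R;
  out_size : nat;
  emb_query : nterms.-tuple term -> 'rV[R]_dim;
  nnodes : nat -> nat;
  children : nat -> nat -> seq nat;
  subs : nat -> seq nat;
  subblock : nat -> seq 'I_ndocs;
  lex_codec : nat -> codec (lex_row R term);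
  vec_codec : codec (seq 'rV[R]_dim)
}.

Definition ceil_div (a b : nat) : nat := ((a + b.-1) %/ b)%N.

(* [up_log r x] is the least [e] with [x <= r ^ e], and [N / B <= r ^ e] iff
   [ceil_div N B <= r ^ e]. *)
Definition height (R : realType) (P : params R) : nat :=
  (up_log (arity P) (ceil_div (ndocs P) (leaf_size P))).+1.

Definition leaf_docs (R : realType) (P : params R) (b : nat) :
    seq 'I_(ndocs P) :=
  flatten [seq subblock P p | p <- subs P b].

Fixpoint subtree_docs (R : realType) (P : params R) (h l b : nat) :
    seq 'I_(ndocs P) :=
  if h is h'.+1
  then flatten [seq subtree_docs P h' l.+1 c | c <- children P l b]
  else leaf_docs P b.

Definition block_docs (R : realType) (P : params R) (l b : nat) :
    seq 'I_(ndocs P) :=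
  subtree_docs P (height P - l) l b.

Definition vocabulary (R : realType) (P : params R) : seq (term P) :=
  undup (flatten [seq corpus D | D <- enum 'I_(ndocs P)]).

Definition block_words (R : realType) (P : params R) (l b : nat) :
    seq (term P) :=
  undup (flatten [seq corpus D | D <- block_docs P l b]).

(* The largest score of [w] over a list of documents; 0 on the empty list, which
   does not occur for a block or a sub-block of a well-formed tree. *)
Definition sigma (R : realType) (P : params R) (w : term P)
    (ds : seq 'I_(ndocs P)) : R :=
  if ds is D0 :: ds'
  then \big[Num.max/score w D0]_(D <- ds') score w D
  else 0.

Definition lex_count (R : realType) (P : params R) (l : nat) : nat :=
  count (fun wb => sigma wb.1 (block_docs P l wb.2) != 0)
        [seq (w, b) | w <- vocabulary P, b <- iota 0 (nnodes P l)].

Definition lex_rows (R : realType) (P : params R) (l : nat) : nat :=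
  `| Num.ceil ((lex_count P l)%:R / load P) |%N.

Definition vec_rows (R : realType) (P : params R) : nat :=
  ceil_div (ndocs P) (sub_size P).

(* The last conjunct says that the beam always contains at least [nsub]
   sub-blocks, so that "the top [nsub] sub-blocks" is meaningful. *)
Definition well_formed (R : realType) (P : params R) : Prop :=
  [/\ (0 < ndocs P)%N, (0 < leaf_size P)%N, (0 < sub_size P)%N,
      (1 < arity P)%N & (0 < beam P)%N] /\
  0 < load P <= 1 /\
  [/\ nnodes P 1 = 1%N,
      nnodes P (height P) = ceil_div (ndocs P) (leaf_size P),
      forall l, (0 < l < height P)%N ->
        (forall b, (b < nnodes P l)%N ->
           (0 < size (children P l b) <= arity P)%N) /\
        perm_eq (flatten [seq children P l b | b <- iota 0 (nnodes P l)])
                (iota 0 (nnodes P l.+1)),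
      forall b, (b < nnodes P (height P))%N ->
        (size (leaf_docs P b) <= leaf_size P)%N /\
        (size (subs P b) <= ceil_div (leaf_size P) (sub_size P))%N &
      perm_eq (flatten [seq subs P b | b <- iota 0 (nnodes P (height P))])
              (iota 0 (vec_rows P))] /\
  (forall p, (p < vec_rows P)%N -> (size (subblock P p) <= sub_size P)%N) /\
  perm_eq (flatten [seq subblock P p | p <- iota 0 (vec_rows P)])
          (enum 'I_(ndocs P)) /\
  (forall (a : 'I_(nhash P)) (w : term P) (l b : nat),
     (0 < l <= height P)%N -> (b < nnodes P l)%N ->
     (hash a w l b < lex_rows P l)%N) /\
  (forall F : seq nat,
     uniq F -> all (fun b => b < nnodes P (height P))%N F ->
     size F = minn (beam P) (nnodes P (height P)) ->
     (nsub P <= sumn [seq size (subs P b) | b <- F])%N).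

(** * Preprocessing *)

(* Units scored by the tuples stored at level [l]: the children of the node, or
   the sub-blocks of the leaf block if [l] is the last level. *)
Definition parts (R : realType) (P : params R) (l b : nat) : seq nat :=
  if (l < height P)%N then children P l b else subs P b.

Definition part_docs (R : realType) (P : params R) (l c : nat) :
    seq 'I_(ndocs P) :=
  if (l < height P)%N then block_docs P l.+1 c else subblock P c.

Definition max_parts (R : realType) (P : params R) (l : nat) : nat :=
  if (l < height P)%N then arity P
  else ceil_div (leaf_size P) (sub_size P).

(* The score fields of missing children or sub-blocks are 0. *)
Definition lex_tuple (R : realType) (P : params R) (l : nat) (w : term P)
    (b : nat) : term P * nat * seq R :=
  let fields := [seq sigma w (part_docs P l c) | c <- parts P l b] in
  (w, b, fields ++ nseq (max_parts P l - size fields) 0).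

Definition lex_tuples (R : realType) (P : params R) (l : nat) :
    seq (term P * nat * seq R) :=
  flatten [seq [seq lex_tuple l w b | w <- block_words P l b]
          | b <- iota 0 (nnodes P l)].

(* The possible outcomes of cuckoo hashing: every tuple is stored exactly once,
   in one of the rows given by its hash values. *)
Definition cuckoo_table (R : realType) (P : params R) (l : nat)
    (T : seq (lex_row R (term P))) : Prop :=
  [/\ size T = lex_rows P l,
      perm_eq (pmap id T) (lex_tuples P l) &
      forall (p : nat) (x : term P * nat * seq R),
        (p < size T)%N -> nth None T p = Some x ->
        exists a : 'I_(nhash P), p = hash a x.1.1 l x.1.2].

Definition vec_table (R : realType) (P : params R) :
    seq (seq 'rV[R]_(dim P)) :=
  [seq [seq emb_doc D | D <- subblock P p] | p <- iota 0 (vec_rows P)].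

(* [DB l] is the lexical table of level [l]. *)
Definition preprocessed (R : realType) (P : params R)
    (DB : nat -> seq (lex_row R (term P))) : Prop :=
  (forall l, (0 < l <= height P)%N ->
     cuckoo_table l (DB l) /\ lossless (lex_codec P l) (DB l)) /\
  lossless (vec_codec P) (vec_table P).

(** * Online phase *)

(* The messages received by the server, each with the number of the database to
   which it is addressed. *)
Definition view := seq (nat * bits).

(* A randomised computation of the client that also produces the messages sent
   to the server. *)
Definition session (A : Type) := dist (view * A).

Definition sret (A : Type) (x : A) : session A := Ret ([::], x).

Definition sbind (A B : Type) (m : session A) (f : A -> session B) : session B :=
  bind m (fun va => bind (f va.2) (fun vb => Ret (va.1 ++ vb.1, vb.2))).

Fixpoint traverse (A B : Type) (f : A -> session B) (s : seq A) :
    session (seq B) :=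
  if s is x :: s'
  then sbind (f x) (fun y => sbind (traverse f s') (fun ys => sret (y :: ys)))
  else sret [::].

(* Retrieve row [i] of database number [id], with rows [rows]. *)
Definition fetch (T : Type) (Pi : pir_scheme) (lam id : nat) (c : codec T)
    (rows : seq T) (i : nat) : session T :=
  bind (retrieve Pi lam (width c) (map (enc c) rows) i)
       (fun qx => Ret ([:: (id, qx.1)], dec c qx.2)).

(* The score fields of the first retrieved row that matches [w] and [b]. *)
Definition matching (R : realType) (T : eqType) (w : T) (b : nat)
    (rows : seq (lex_row R T)) : seq R :=
  head [::] [seq x.2 | x <- pmap id rows & x.1 == (w, b)].

(* Retrieves, for every word of the query, the candidate rows of the nodes of the
   frontier [F] of level [l]; returns the parts of these nodes with their scores
   with respect to the query. *)
Definition scored_parts (R : realType) (P : params R)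
    (DB : nat -> seq (lex_row R (term P))) (Pi : pir_scheme) (lam : nat)
    (Q : (nterms P).-tuple (term P)) (l : nat) (F : seq nat) :
    session (seq (nat * R)) :=
  sbind
    (traverse
       (fun w =>
          sbind (traverse (fetch Pi lam l (lex_codec P l) (DB l))
                          [seq hash a w l b | b <- F, a <- enum 'I_(nhash P)])
                (fun rows => sret (w, rows)))
       Q)
    (fun got =>
       sret (flatten
         [seq [seq (nth 0%N (parts P l b) j,
                    \sum_(wr <- got) (matching wr.1 b wr.2)`_j)
              | j <- iota 0 (size (parts P l b))]
         | b <- F])).

(* Ties are broken by the order of enumeration ([sort] is stable). *)
Definition top (R : realType) (T : Type) (n : nat) (s : seq (T * R)) : seq T :=
  [seq x.1 | x <- take n (sort (fun x y : T * R => y.2 <= x.2) s)].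

Fixpoint descend (R : realType) (P : params R)
    (DB : nat -> seq (lex_row R (term P))) (Pi : pir_scheme) (lam : nat)
    (Q : (nterms P).-tuple (term P)) (h l : nat) (F : seq nat) :
    session (seq nat) :=
  if h is h'.+1
  then sbind (scored_parts DB Pi lam Q l F) (fun s =>
         descend DB Pi lam Q h' l.+1 (top (minn (beam P) (nnodes P l.+1)) s))
  else sret F.

Definition cosine (R : realType) (d : nat) (u v : 'rV[R]_d) : R :=
  let dot (x y : 'rV[R]_d) := (x *m y^T) 0 0 in
  dot u v / (Num.sqrt (dot u u) * Num.sqrt (dot v v)).

(* The vector database has number [(height P).+1]. *)
Definition pillar_tree (R : realType) (P : params R)
    (DB : nat -> seq (lex_row R (term P))) (Pi : pir_scheme) (lam : nat)
    (Q : (nterms P).-tuple (term P)) : session (seq 'I_(ndocs P)) :=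
  sbind (descend DB Pi lam Q (height P).-1 1 [:: 0%N]) (fun F =>
  sbind (scored_parts DB Pi lam Q (height P) F) (fun s =>
  let selected := top (nsub P) s in
  sbind (traverse (fetch Pi lam (height P).+1 (vec_codec P) (vec_table P))
                  selected) (fun vecs =>
  sret (top (out_size P)
         (flatten [seq [seq (De.1, cosine (emb_query Q) De.2)
                       | De <- zip (subblock P pv.1) pv.2]
                  | pv <- zip selected vecs]))))).

(** * Security *)

(* A prefix code of the messages, so that a view is a single string. *)
Definition encode_message (m : nat * bits) : bits :=
  unary m.1 ++ false :: flatten [seq [:: true; b] | b <- m.2] ++ [:: false].

Definition encode_view (v : view) : bits := flatten (map encode_message v).

Definition server_view (R : realType) (P : params R)
    (DB : nat -> seq (lex_row R (term P))) (Pi : pir_scheme) (lam : nat)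
    (Q : (nterms P).-tuple (term P)) : dist bits :=
  bind (pillar_tree DB Pi lam Q) (fun vo => Ret (encode_view vo.1)).

(* The simulator depends on the public parameters only (not on the query) and
   receives the security parameter as input; the negligible bound is uniform in
   the query. *)
Definition secure_against_semi_honest_server (R : realType) (Pi : pir_scheme)
    (P : params R) : Prop :=
  exists Sim : ppt,
    forall DB : nat -> seq (lex_row R (term P)), preprocessed DB ->
    forall D : ppt,
    exists nu : nat -> R, negligible nu /\
      forall (lam : nat) (Q : (nterms P).-tuple (term P)),
        `| Pr_accept R D lam (server_view DB Pi lam Q)
           - Pr_accept R D lam (output Sim [:: unary lam]) | <= nu lam.

(* Main.v *)
(* With a negligible error the PIR answers decode to the right records, and then
   the client's whole execution is a deterministic function of the query: the
   server sees independent PIR queries for a sequence of databases fixed by the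
   public parameters, at positions determined by the query.  (The size of each
   frontier is public because every node has a child and the children of a level
   exhaust the next one.)  The simulator queries position 0 throughout.  Replacing
   the positions one at a time, a distinguisher between consecutive hybrids yields
   a distinguisher against the PIR scheme that has the other positions hard-coded.
   There are finitely many sequences of positions, so the sum of the resulting
   advantages is negligible and bounds the error uniformly in the query.

   The simulator and the reduction are actual programs: they run the PIR query
   algorithm and the distinguisher in disjoint families of stacks. *)
Require Import Defs.
From mathcomp Require Import all_boot all_order all_algebra.
From mathcomp Require Import boolp reals.
From mathcomp Require Import zify lra.

Set Implicit Arguments.
Unset Strict Implicit.
Unset Printing Implicit Defensive.

Import Order.TTheory GRing.Theory Num.Theory.

Local Open Scope ring_scope.

(** * Expectations over coin-flip trees *)

Lemma bindA (A B C : Type) (d : dist A) (f : A -> dist B) (g : B -> dist C) :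
  bind (bind d f) g = bind d (fun a => bind (f a) g).
Proof. by elim: d => //= h IH; congr Flip; apply: funext. Qed.

Lemma bind_Ret (A : Type) (d : dist A) : bind d (@Ret A) = d.
Proof. by elim: d => //= h IH; congr Flip; apply: funext. Qed.

Lemma eq_bind (A B : Type) (d : dist A) (f g : A -> dist B) :
  f =1 g -> bind d f = bind d g.
Proof. by move=> fg; congr bind; apply: funext. Qed.

Section Expectation.
Variable R : realType.

Fixpoint Ex (A : Type) (g : A -> R) (d : dist A) : R :=
  match d with
  | Ret a => g a
  | Flip h => (Ex g (h true) + Ex g (h false)) / 2
  end.

Lemma eq_Ex (A : Type) (g h : A -> R) (d : dist A) : g =1 h -> Ex g d = Ex h d.
Proof. by move=> gh; congr Ex; apply: funext. Qed.

Lemma Pr_Ex (A : Type) (E : A -> bool) (d : dist A) :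
  Pr R E d = Ex (fun a => (E a)%:R) d.
Proof. by elim: d => //= h IH; rewrite !IH. Qed.

Lemma Ex_bind (A B : Type) (g : B -> R) (d : dist A) (f : A -> dist B) :
  Ex g (bind d f) = Ex (fun a => Ex g (f a)) d.
Proof. by elim: d => //= h IH; rewrite !IH. Qed.

Lemma Pr_bind (A B : Type) (E : B -> bool) (d : dist A) (f : A -> dist B) :
  Pr R E (bind d f) = Ex (fun a => Pr R E (f a)) d.
Proof. by rewrite Pr_Ex Ex_bind; apply: eq_Ex => a; rewrite Pr_Ex. Qed.

Lemma Ex_cst (A : Type) (c : R) (d : dist A) : Ex (fun=> c) d = c.
Proof. by elim: d => //= h IH; rewrite !IH; lra. Qed.

Lemma ExB (A : Type) (g h : A -> R) (d : dist A) :
  Ex (fun a => g a - h a) d = Ex g d - Ex h d.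
Proof. by elim: d => //= k IH; rewrite !IH; lra. Qed.

Lemma le_Ex (A : Type) (g h : A -> R) (d : dist A) :
  (forall a, g a <= h a) -> Ex g d <= Ex h d.
Proof.
move=> gh; elim: d => //= k IH.
by have := IH true; have := IH false; lra.
Qed.

Lemma norm_Ex (A : Type) (g : A -> R) (d : dist A) :
  `|Ex g d| <= Ex (fun a => `|g a|) d.
Proof.
elim: d => //= k IH; have := IH true; have := IH false.
by rewrite !ler_norml => /andP[? ?] /andP[? ?]; apply/andP; split; lra.
Qed.

(** Fubini. The reduction receives its challenge first, whereas the transcript samples it after the
    prefix. *)
Lemma Ex_swap (A B : Type) (g : A -> B -> R) (d : dist A) (e : dist B) :
  Ex (fun a => Ex (g a) e) d = Ex (fun b => Ex (g^~ b) d) e.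
Proof.
elim: d => //= h IH; rewrite !IH; elim: e {IH} => //= k IH.
by have := IH true; have := IH false; lra.
Qed.

Definition test (A : Type) (g : A -> R) : Prop := forall a, 0 <= g a <= 1.

Lemma Ex_test (A B : Type) (g : B -> R) (f : A -> dist B) :
  test g -> test (fun a => Ex g (f a)).
Proof.
move=> tg a; rewrite -{1}(Ex_cst 0 (f a)) -(Ex_cst 1 (f a)).
by rewrite !le_Ex// => b; case/andP: (tg b).
Qed.

Lemma Pr_test (A : Type) (E : A -> bool) (d : dist A) : 0 <= Pr R E d <= 1.
Proof.
elim: d => [a|h IH] /=; first by rewrite ler0n lern1 leq_b1.
by have := IH true; have := IH false; lra.
Qed.

(** Statistical distance, tested by functions into the unit interval rather than by events:
    composing a test with a randomised continuation gives a test again, so errors add up along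
    [bind]. *)
Definition close (e : R) (A : Type) (d1 d2 : dist A) : Prop :=
  forall g, test g -> `|Ex g d1 - Ex g d2| <= e.

Lemma close_refl (A : Type) (d : dist A) : close 0 d d.
Proof. by move=> g _; rewrite subrr normr0. Qed.

Lemma close_bind (e e' : R) (A B : Type) (d1 d2 : dist A) (f1 f2 : A -> dist B) :
  close e d1 d2 -> (forall a, close e' (f1 a) (f2 a)) ->
  close (e + e') (bind d1 f1) (bind d2 f2).
Proof.
move=> d12 f12 g tg; rewrite !Ex_bind.
apply: le_trans (ler_distD (Ex (fun a => Ex g (f1 a)) d2) _ _) _.
apply: lerD; first by apply: d12; apply: Ex_test.
rewrite -ExB; apply: le_trans (norm_Ex _ _) _.
by rewrite -[leRHS](Ex_cst e' d2); apply: le_Ex => a; apply: f12.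
Qed.

(** * Negligible functions *)

Lemma negligible0 : @negligible R (fun=> 0).
Proof.
move=> c; exists 0%N => n n0; rewrite normr0 invr_gt0 exprn_gt0// ltr0n//.
Qed.

Lemma negligible_norm (nu : nat -> R) :
  negligible nu -> negligible (fun n => `|nu n|).
Proof. by move=> H c; have [n0 P] := H c; exists n0 => n /P; rewrite normr_id. Qed.

Lemma negligibleD (nu mu : nat -> R) :
  negligible nu -> negligible mu -> negligible (fun n => nu n + mu n).
Proof.
(* The exponent [c.+1] pays for the factor 2: twice [n ^- c.+1] is at most [n ^- c] as soon as [n]
   exceeds 1. *)
move=> H K c; have [a P] := H c.+1; have [b Q] := K c.+1.
exists (maxn 1 (maxn a b)) => n; rewrite !gtn_max => /and3P[n1 /P Pn /Q Qn].
apply: le_lt_trans (ler_normD _ _) _.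
apply: lt_le_trans (ltrD Pn Qn) _.
have n0 : (0 : R) < n%:R by rewrite ltr0n; lia.
have nc : 0 < n%:R ^+ c :> R by rewrite exprn_gt0.
rewrite exprS invfM -mulrDl -[leRHS]mul1r ler_wpM2r ?invr_ge0 ?(ltW nc)//.
have : n%:R^-1 <= 2^-1 :> R by rewrite lef_pV2 ?posrE// (ler_nat _ 2 n).
lra.
Qed.

Lemma negligible_sum (I : Type) (r : seq I) (nu : I -> nat -> R) :
  (forall i, negligible (nu i)) -> negligible (fun n => \sum_(i <- r) nu i n).
Proof.
move=> H; elim: r => [|i r IH].
  by under eq_fun do rewrite big_nil; apply: negligible0.
by under eq_fun do rewrite big_cons; apply: negligibleD.
Qed.

Lemma negligible_muln (nu : nat -> R) (k : nat) :
  negligible nu -> negligible (fun n => nu n *+ k).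
Proof.
move=> H; elim: k => [|k IH].
  by under eq_fun do rewrite mulr0n; apply: negligible0.
by under eq_fun do rewrite mulrS; apply: negligibleD.
Qed.

End Expectation.

(** * Running programs *)

Fixpoint always (A : Type) (E : A -> Prop) (d : dist A) : Prop :=
  match d with
  | Ret a => E a
  | Flip g => forall b, always E (g b)
  end.

Lemma surely_always (A : Type) (E : A -> bool) (d : dist A) :
  surely E d <-> always E d.
Proof. by elim: d => //= g IH; split=> H b; apply/IH. Qed.

Lemma always_impl (A : Type) (E F : A -> Prop) (d : dist A) :
  (forall a, E a -> F a) -> always E d -> always F d.
Proof. by move=> EF; elim: d => [a /EF//|g IH /= H b]; apply: IH. Qed.

Lemma always_bind (A B : Type) (E : B -> Prop) (d : dist A) (f : A -> dist B) :
  always E (bind d f) <-> always (fun a => always E (f a)) d.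
Proof. by elim: d => //= g IH; split=> H b; apply/IH. Qed.

Lemma eq_bind_always (A B : Type) (d : dist A) (f g : A -> dist B) :
  always (fun a => f a = g a) d -> bind d f = bind d g.
Proof. by elim: d => //= h IH H; congr Flip; apply: funext => b; apply: IH. Qed.

Lemma always_true (A : Type) (E : A -> Prop) (d : dist A) :
  (forall a, E a) -> always E d.
Proof. by move=> H; elim: d => //=. Qed.

(* [code] started in [st] halts within [t] steps, and [d] is the distribution of
   the final stacks. *)
Definition evals (t : nat) (code : seq instr) (st : store) (d : dist store) :
    Prop :=
  steps t (code, st) = bind d (fun st' => Ret ([::], st')).

Definition final (t : nat) (code : seq instr) (st : store) : dist store :=
  bind (steps t (code, st)) (fun c => Ret c.2).

Lemma stepsD (t s : nat) (c : seq instr * store) :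
  steps (t + s) c = bind (steps t c) (steps s).
Proof.
elim: t c => //= t IH c; rewrite bindA; congr bind; apply: funext => c'.
exact: IH.
Qed.

Lemma stepsS (t : nat) (c : seq instr * store) :
  steps t.+1 c = bind (step c) (steps t).
Proof. by []. Qed.

Lemma steps_nil (t : nat) (st : store) : steps t ([::], st) = Ret ([::], st).
Proof. by elim: t. Qed.

Lemma evals_le (t t' : nat) (code : seq instr) (st : store) (d : dist store) :
  (t <= t')%N -> evals t code st d -> evals t' code st d.
Proof.
move=> tt' H; rewrite /evals -(subnKC tt') stepsD H bindA.
by apply: eq_bind => st' /=; rewrite steps_nil.
Qed.

Lemma evals_halted (t : nat) (code : seq instr) (st : store) :
  surely halted (steps t (code, st)) -> evals t code st (final t code st).
Proof.
move/surely_always => H; rewrite /evals /final bindA -[LHS]bind_Ret.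
by apply: eq_bind_always; apply: always_impl H => -[[|//] ? _].
Qed.

Lemma evals_surely (t : nat) (code : seq instr) (st : store) (d : dist store) :
  evals t code st d -> surely halted (steps t (code, st)).
Proof. by move=> ->; apply/surely_always/always_bind/always_true. Qed.

(** Halted configurations are stable, so both runs can be prolonged to the larger of the two times,
    where they coincide. *)
Lemma evals_final (t t' : nat) (code : seq instr) (st : store) (d : dist store) :
  evals t code st d -> surely halted (steps t' (code, st)) ->
  final t' code st = d.
Proof.
move=> H /evals_halted H'.
have := evals_le (leq_maxr t t') H'; have := evals_le (leq_maxl t t') H.
rewrite /evals => -> /(congr1 (fun d => bind d (fun c => Ret c.2))).
by rewrite !bindA /= !bind_Ret.
Qed.

(** A step looks only at the head instruction, so any code appended behind it is carried along
    unchanged. *)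
Lemma step_cat (i : instr) (c1 c2 : seq instr) (st : store) :
  step (i :: c1 ++ c2, st) =
  bind (step (i :: c1, st)) (fun c => Ret (c.1 ++ c2, c.2)).
Proof.
case: i => //= [x p0 p1 p2|x p]; first by rewrite catA.
by case: (st x) => //= _ _; rewrite -catA.
Qed.

Lemma evals_cat (t1 t2 : nat) (c1 c2 : seq instr) (st : store) (d : dist store)
    (f : store -> dist store) :
  evals t1 c1 st d -> always (fun st' => evals t2 c2 st' (f st')) d ->
  evals (t1 + t2) (c1 ++ c2) st (bind d f).
Proof.
elim: t1 c1 st d => [|t1 IH] c1 st d.
  by rewrite /evals /=; case: d => //= st' [-> ->].
case: c1 => [|i c1].
  rewrite {1}/evals steps_nil; case: d => //= st' [->].
  by apply: evals_le; lia.
rewrite /evals addSn !stepsS cat_cons step_cat bindA.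
(* Induction on the coins of the first step; the equation forces [d] to branch in the same way. *)
elim: (step (i :: c1, st)) d => [[c' st'] d|g IHg [//|h] /=]; first exact: IH.
case=> gh H; congr Flip; apply: funext => b.
exact: IHg (congr1 (@^~ b) gh) (H b).
Qed.

(** A coin-flip tree has finitely many leaves, so the halting times at its leaves have a maximum. *)
Lemma always_evals (code : seq instr) (f : store -> dist store) (d : dist store) :
  always (fun st => exists t, evals t code st (f st)) d ->
  exists t, always (fun st => evals t code st (f st)) d.
Proof.
elim: d => //= g IH H; have [t1 H1] := IH _ (H true).
have [t2 H2] := IH _ (H false); exists (maxn t1 t2); case.
  by apply: always_impl H1 => st; apply: evals_le; apply: leq_maxl.
by apply: always_impl H2 => st; apply: evals_le; apply: leq_maxr.
Qed.

(** * Polynomial time *)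

(** The total length of all stacks is at most [N]; the infinite sum is expressed through its finite
    partial sums. Finite support makes such a store the initial store of some list of inputs. *)
Definition bounded (N : nat) (st : store) : Prop :=
  (exists m, forall x, (m <= x)%N -> st x = [::]) /\
  (forall r : seq nat, uniq r -> (\sum_(x <- r) size (st x) <= N)%N).

Lemma bounded_le (N N' : nat) (st : store) :
  (N <= N')%N -> bounded N st -> bounded N' st.
Proof. by move=> NN' [E H]; split=> // r /H /leq_trans; apply. Qed.

Lemma bounded_size (N : nat) (st : store) (x : nat) :
  bounded N st -> (size (st x) <= N)%N.
Proof. by move=> [_ /(_ [:: x] isT)]; rewrite big_seq1. Qed.

Lemma bounded_nth (inputs : seq bits) :
  bounded (sumn (map size inputs)) (nth [::] inputs).
Proof.
split; first by exists (size inputs) => x; apply: nth_default.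
move=> r ur; pose n := size inputs.
have -> : (\sum_(x <- r) size (nth [::] inputs x) =
           \sum_(x <- r | (x < n)%N) size (nth [::] inputs x))%N.
  rewrite [RHS]big_mkcond; apply: eq_bigr => x _.
  by case: ltnP => // nx; rewrite nth_default.
rewrite -big_filter.
have -> : sumn (map size inputs) = (\sum_(x <- iota 0 n) size (nth [::] inputs x))%N.
  by rewrite sumnE big_map (big_nth [::]) /index_iota subn0.
have /(perm_big _) -> : perm_eq [seq x <- r | (x < n)%N] [seq x <- iota 0 n | x \in r].
  apply: uniq_perm; rewrite ?filter_uniq ?iota_uniq// => x.
  by rewrite !mem_filter mem_iota add0n andbC.
rewrite big_filter big_mkcond; apply: leq_sum => x _.
by case: ifP.
Qed.

Lemma bounded_inputs (N : nat) (st : store) : bounded N st ->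
  exists2 inputs, st = nth [::] inputs & (sumn (map size inputs) <= N)%N.
Proof.
move=> [[m E] H]; exists (mkseq st m).
  apply: funext => x; have [xm|mx] := ltnP x m; first by rewrite nth_mkseq.
  by rewrite E// nth_default// size_mkseq.
by rewrite sumnE !big_map; apply: H; apply: iota_uniq.
Qed.

Lemma bounded_update (N : nat) (st : store) (x : nat) (s : bits) :
  (size s <= (size (st x)).+1)%N -> bounded N st -> bounded N.+1 (update st x s).
Proof.
move=> ss [[m E] H]; split.
  exists (maxn m x.+1) => y; rewrite /update geq_max => /andP[/E -> xy].
  by case: eqP => // yx; lia.
move=> r ur; apply: (@leq_trans (\sum_(y <- r) (size (st y) + (y == x)))%N).
  by apply: leq_sum => y _; rewrite /update; case: eqP => [->|]; lia.
rewrite big_split /= -addn1 leq_add ?H//.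
have -> : (\sum_(y <- r) (y == x) = count_mem x r)%N.
  by rewrite -sum1_count [RHS]big_mkcond; apply: eq_bigr => y _ /=; case: (y == x).
by rewrite count_uniq_mem//; case: (_ \in _).
Qed.

(** Each step pushes at most one bit. *)
Lemma bounded_steps (N t : nat) (c : seq instr * store) :
  bounded N c.2 -> always (fun c' => bounded (N + t) c'.2) (steps t c).
Proof.
elim: t N c => [|t IH] N c Hc; first by rewrite addn0.
rewrite /=; apply/always_bind; rewrite -addSnnS.
suff : always (fun c' => bounded N.+1 c'.2) (step c).
  by apply: always_impl => c'; apply: IH.
have N1 : bounded N.+1 c.2 by apply: bounded_le Hc.
case: c Hc N1 => [[|[x b|x|x|x p0 p1 p2|x p] k] st] //= Hc N1.
- exact: bounded_update.
- by apply: bounded_update => //; rewrite size_behead; lia.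
- by move=> b; apply: bounded_update.
Qed.

(** Quantifying over all stores, not only initial ones, makes the notion closed under concatenation.
    The base [N + 2] is at least 2, so raising the exponent absorbs constants, sums and products. *)
Definition polytime (code : seq instr) : Prop :=
  exists k, forall N st, bounded N st ->
    surely halted (steps ((N + 2) ^ k) (code, st)).

Lemma halted_le (t t' : nat) (code : seq instr) (st : store) : (t <= t')%N ->
  surely halted (steps t (code, st)) -> surely halted (steps t' (code, st)).
Proof. by move=> tt' /evals_halted /(evals_le tt') /evals_surely. Qed.

Lemma leq_expn (m n k : nat) : (m <= n)%N -> (m ^ k <= n ^ k)%N.
Proof. by case: k => [|k] mn; rewrite ?expn0// leq_exp2r. Qed.

Lemma polytime_cat (c1 c2 : seq instr) :
  polytime c1 -> polytime c2 -> polytime (c1 ++ c2).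
Proof.
(* With base [N + 2], the second program starts with at most [N + t1] bits, and [N + t1 + 2] is at
   most the power [k1 + 2] of the base. One more factor of the base bounds the sum of the two times
   by their product. *)
move=> [k1 H1] [k2 H2]; exists (k1 + (k1 + 2) * k2 + 1)%N => N st Hst.
set t1 := ((N + 2) ^ k1)%N; have E1 := evals_halted (H1 N st Hst).
have E2 : always (fun st' => evals ((N + t1 + 2) ^ k2) c2 st'
    (final ((N + t1 + 2) ^ k2) c2 st')) (final t1 c1 st).
  apply/always_bind; apply: always_impl (bounded_steps t1 (c := (c1, st)) Hst).
  by move=> c' /H2 /evals_halted.
apply: halted_le (evals_surely (evals_cat E1 E2)).
have t1_gt0 : (0 < t1)%N by rewrite expn_gt0 addn2.
have le1 : (N + t1 + 2 <= (N + 2) ^ (k1 + 2))%N.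
  by rewrite expnD -/t1 expnS expn1; nia.
have le2 : ((N + t1 + 2) ^ k2 <= (N + 2) ^ ((k1 + 2) * k2))%N.
  by rewrite expnM leq_expn.
rewrite !expnD expn1 -/t1.
have : (0 < (N + 2) ^ ((k1 + 2) * k2))%N by rewrite expn_gt0 addn2.
by move: le2; move: (_ ^ _)%N => a; move: (_ ^ (_ * _))%N => b; nia.
Qed.

Lemma polytime_evals (code : seq instr) (k : nat) :
  (forall N st, bounded N st -> exists d, evals ((N + 2) ^ k) code st d) ->
  polytime code.
Proof. by move=> H; exists k => N st /H[d /evals_surely]. Qed.

Lemma polytime_ppt_code (M : ppt) : polytime (ppt_code M).
Proof.
case: M => code k H /=; exists k.+1 => N st.
case/bounded_inputs=> inputs -> le_inputs; apply: halted_le (H inputs).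
have le1 : (sumn (map size inputs) ^ k <= (N + 2) ^ k)%N by apply: leq_expn; lia.
have le2 : (k <= (N + 2) ^ k)%N.
  by apply: leq_trans (ltnW (ltn_expl k (ltnSn 1))) _; apply: leq_expn; lia.
by rewrite /time_bound expnS; nia.
Qed.

Lemma ppt_of_polytime (code : seq instr) :
  polytime code -> exists M : ppt, ppt_code M = code.
Proof.
move=> [k H].
suff [k' H'] : exists k', forall inputs : seq bits,
    surely halted (steps (time_bound k' inputs) (initial code inputs)).
  by exists (PPT H').
(* For total input size [S] at most 1, [(S + 2) ^ k] is at most the constant [3 ^ k]; otherwise
   [S + 2 <= S ^ 2], which costs the exponent [2 * k]. *)
exists (3 ^ k + 2 * k)%N => inputs; apply: halted_le (H _ _ (bounded_nth inputs)).
rewrite /time_bound; move: (sumn _) => S.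
have [S1|S2] := leqP S 1.
  by have := @leq_expn (S + 2) 3 k; lia.
apply: leq_trans (leq_addr _ _); apply: leq_trans (_ : (S ^ 2) ^ k <= _)%N.
  by apply: leq_expn; nia.
by rewrite -expnM leq_pexp2l; lia.
Qed.

(** * Transferring the contents of a stack *)

Definition code_put (l : seq (nat * bool)) : seq instr :=
  [seq Push yb.1 yb.2 | yb <- l].

Definition put (st : store) (l : seq (nat * bool)) : store :=
  foldl (fun st yb => update st yb.1 (yb.2 :: st yb.1)) st l.

Lemma putE (st : store) (l : seq (nat * bool)) (y : nat) :
  put st l y = rev [seq yb.2 | yb <- l & yb.1 == y] ++ st y.
Proof.
elim: l st => //= -[x b] l IH st; rewrite IH /update eq_sym /=.
by case: eqP => //= <-; rewrite rev_cons cat_rcons.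
Qed.

Lemma evals_put (st : store) (l : seq (nat * bool)) :
  evals (size l) (code_put l) st (Ret (put st l)).
Proof. by elim: l st => //= x l IH st; apply: IH. Qed.

Lemma polytime_put (l : seq (nat * bool)) : polytime (code_put l).
Proof.
apply: (@polytime_evals _ (size l)) => N st _; exists (Ret (put st l)).
apply: evals_le (evals_put st l); apply: leq_trans (ltnW (ltn_expl _ (ltnSn 1))) _.
by apply: leq_expn; lia.
Qed.

(** One loop serves to erase, move, copy or encode a stack, depending on the pushes [f]. A moved
    stack arrives reversed. The branch of [Case] for an empty stack is never taken, since [While]
    has just tested for it. *)
Definition drain (x : nat) (f : bool -> seq (nat * bool)) : seq instr :=
  [:: While x [:: Case x [::] (Pop x :: code_put (f false))
                              (Pop x :: code_put (f true))]].

Definition drained (x : nat) (f : bool -> seq (nat * bool)) (st : store) : store :=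
  put (update st x [::]) (flatten (map f (st x))).

Arguments drained : simpl never.

Definition avoids (x : nat) (f : bool -> seq (nat * bool)) : Prop :=
  forall b, x \notin map fst (f b).

(** As the pushes avoid [x], each turn shortens it by one bit. A turn costs one [While], one [Case],
    one [Pop] and at most [c] pushes; the final 1 is the [While] that finds [x] empty. *)
Lemma evals_drain (x c : nat) (f : bool -> seq (nat * bool)) (st : store) :
  avoids x f -> (forall b, (size (f b) <= c)%N) ->
  evals (size (st x) * (c + 3) + 1) (drain x f) st (Ret (drained x f st)).
Proof.
move=> fx fc; rewrite /drained; move: {2 3}(st x) (erefl (st x)) => s.
elim: s st => [|b s IH] st st_x.
  rewrite st_x /evals /= st_x; congr (Ret (_, _)); apply: funext => y.
  by rewrite /update; case: eqP => [->|].
pose st' := put (update st x s) (f b).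
have noput l (st0 : store) : x \notin map fst l -> put st0 l x = st0 x.
  move=> xl; rewrite putE (_ : [seq yb <- l | yb.1 == x] = [::])//.
  apply/eqP; rewrite -size_eq0 size_filter -leqn0 leqNgt -has_count.
  by apply/hasP => -[yb ybl /eqP ybx]; case/negP: xl; rewrite -ybx map_f.
have st'_x : st' x = s by rewrite /st' noput// /update eqxx.
have := IH st' st'_x; rewrite st_x st'_x /= mulSn addnAC.
(* Clearing [x] commutes with the pushes of [f b], which avoid [x]. *)
have -> : put (update st' x [::]) (flatten (map f s)) =
          put (update st x [::]) (f b ++ flatten (map f s)).
  rewrite /put foldl_cat -!/(put _ _); congr put; apply: funext => y.
  rewrite /update /st' [RHS]putE /=; case: (y =P x) => [->|yx].
    have := noput (f b) (fun=> [::]) (fx b); rewrite putE cats0 => ->.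
    by [].
  by rewrite putE /update; case: eqP.
move=> E; have := @evals_cat (size (f b)) _ (code_put (f b)) (drain x f)
  (update st x s) _ (fun=> _) (evals_put _ _) E.
rewrite -/st' /= => E'; apply: (@evals_le (3 + (size (f b) + (size s * (c + 3) + 1)))).
  by have := fc b; lia.
rewrite /evals !addSn add0n !stepsS /= st_x /= st_x.
by case: b {st' st'_x noput E} st_x E' => st_x E' /=; rewrite st_x.
Qed.

Lemma polytime_drain (x : nat) (f : bool -> seq (nat * bool)) :
  avoids x f -> polytime (drain x f).
Proof.
move=> fx; pose c := (size (f true) + size (f false))%N.
apply: (@polytime_evals _ (c + 3).+1) => N st Hst; exists (Ret (drained x f st)).
apply: evals_le (evals_drain st fx (_ : forall b, (size (f b) <= c)%N)); last first.
  by rewrite /c; case; lia.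
have le1 := bounded_size x Hst; have le2 := ltn_expl (c + 3) (ltnSn 1).
have le3 := @leq_expn 2 (N + 2) (c + 3) (leq_addl _ _).
by rewrite expnS; nia.
Qed.

(** * Running programs in disjoint slots *)

(* Slot [j] is an infinite family of stacks; the stacks 0 and 1, which hold the
   inputs, are the first stacks of slots 0 and 1. *)
Definition reg (j x : nat) : nat := iter j (fun n => n.*2.+1) x.*2.

Arguments reg : simpl never.

(** In binary, [reg j x] is [x] followed by a zero and [j] ones: the number of trailing ones tells
    the slot. *)
Fixpoint unreg (j y : nat) : option nat :=
  if j is j'.+1 then if odd y then unreg j' y./2 else None
  else if odd y then None else Some y./2.

Lemma regK (j i x : nat) : unreg j (reg i x) = if i == j then Some x else None.
Proof.
elim: j i => [|j IH] [|i] //=; rewrite /reg /= ?odd_double ?doubleK//.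
by rewrite uphalf_double IH.
Qed.

Lemma unregK (j y x : nat) : unreg j y = Some x -> y = reg j x.
Proof.
elim: j y => [|j IH] y /=; case: ifP => // oy.
  by case=> <-; rewrite /reg /= even_halfK// oy.
by move/IH => yE; rewrite /reg /= -/(reg j x) -yE; have := odd_double_half y; rewrite oy.
Qed.

Lemma reg_eq (i j x y : nat) : (reg i x == reg j y) = (i == j) && (x == y).
Proof.
apply/eqP/andP => [e|[/eqP-> /eqP->]//].
by have := regK j i x; rewrite e regK eqxx; case: eqP => // _ [->].
Qed.

Lemma reg_ge (j x : nat) : (x <= reg j x)%N.
Proof. by rewrite /reg; elim: j => [|j IH] /=; lia. Qed.

Definition merge (j : nat) (st0 st : store) : store :=
  fun y => if unreg j y is Some x then st0 x else st y.

Lemma mergeE (j i x : nat) (st0 st : store) :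
  merge j st0 st (reg i x) = if i == j then st0 x else st (reg i x).
Proof. by rewrite /merge regK; case: (i == j). Qed.

Lemma merge_id (j : nat) (st : store) : merge j (fun x => st (reg j x)) st = st.
Proof.
by apply: funext => y; rewrite /merge; case E: unreg => [x|//]; rewrite (unregK E).
Qed.

Lemma update_merge (j x : nat) (st0 st : store) (s : bits) :
  update (merge j st0 st) (reg j x) s = merge j (update st0 x s) st.
Proof.
apply: funext => y; rewrite /update /merge; case E: unreg => [z|].
  by rewrite (unregK E) reg_eq eqxx.
by case: eqP => // yE; move: E; rewrite yE regK eqxx.
Qed.

Fixpoint ren (j : nat) (i : instr) : instr :=
  match i with
  | Push x b => Push (reg j x) b
  | Pop x => Pop (reg j x)
  | Toss x => Toss (reg j x)
  | Case x p0 p1 p2 =>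
      Case (reg j x) (map (ren j) p0) (map (ren j) p1) (map (ren j) p2)
  | While x p => While (reg j x) (map (ren j) p)
  end.

(** Renamed instructions touch slot [j] only, so the run is a lockstep copy of the original one
    inside an inert store. *)
Lemma steps_ren (t j : nat) (st : store) (c : seq instr * store) :
  steps t (map (ren j) c.1, merge j c.2 st) =
  bind (steps t c) (fun c' => Ret (map (ren j) c'.1, merge j c'.2 st)).
Proof.
elim: t c => // t IH c; rewrite !stepsS bindA -(eq_bind _ IH).
rewrite -[in RHS](bindA _ (fun c' => Ret (map (ren j) c'.1, merge j c'.2 st))).
congr bind; case: c => [[|[x b|x|x|x p0 p1 p2|x p] k] st0] //=;
  rewrite ?mergeE ?eqxx ?update_merge//.
- by congr Flip; apply: funext => b; rewrite update_merge.
- by rewrite map_cat; case: (st0 x) => [|[] s].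
- by case: (st0 x) => [|b s] //; rewrite map_cat.
Qed.

Lemma evals_ren (t j : nat) (code : seq instr) (st : store) (d : dist store) :
  evals t code (fun x => st (reg j x)) d ->
  evals t (map (ren j) code) st (bind d (fun st0 => Ret (merge j st0 st))).
Proof.
rewrite /evals -{2}(merge_id j st) => E.
by rewrite (steps_ren t j st (code, _)) E !bindA.
Qed.

(** Since [reg j] is injective and [x <= reg j x], the slot seen as a store of its own inherits the
    bound and the finite support. *)
Lemma polytime_ren (j : nat) (code : seq instr) :
  polytime code -> polytime (map (ren j) code).
Proof.
move=> [k H]; exists k => N st [[m E] Hst]; apply: evals_surely.
apply/evals_ren/evals_halted/H; split.
  by exists m => x mx; apply: E; apply: leq_trans mx (reg_ge j x).
move=> r ur; rewrite -(big_map (reg j) xpredT (fun y => size (st y))).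
by apply: Hst; rewrite map_inj_uniq// => x y /eqP; rewrite reg_eq eqxx => /eqP.
Qed.

Lemma evals_uniq (t t' : nat) (code : seq instr) (st : store) (d d' : dist store) :
  evals t code st d -> evals t' code st d' -> d = d'.
Proof.
move=> H H'; rewrite -(evals_final H (evals_surely H')).
exact: evals_final H' (evals_surely H').
Qed.

Lemma evals_exec (M : ppt) (inputs : seq bits) :
  exists t, evals t (ppt_code M) (nth [::] inputs) (exec M inputs).
Proof.
exists (time_bound (ppt_deg M) inputs); apply: evals_halted.
by case: M => code k H; apply: H.
Qed.

(** The running time is existential: functional correctness is proved with [outputs], and polynomial
    time separately with [polytime]. *)
Definition outputs (code : seq instr) (st : store) (D : dist bits) : Prop :=
  exists t, exists2 d, evals t code st d & bind d (fun st' => Ret (st' 0%N)) = D.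

Lemma outputs_cat (A : Type) (t : nat) (c1 c2 : seq instr) (st : store)
    (d : dist A) (G : A -> store) (f : A -> dist bits) :
  evals t c1 st (bind d (fun a => Ret (G a))) ->
  (forall a, outputs c2 (G a) (f a)) ->
  outputs (c1 ++ c2) st (bind d f).
Proof.
move=> H1 H2.
(* Sequencing needs the final distribution as a function of the store, while the runs of [c2] are
   indexed by [a]. A run is chosen for each store of the form [G a]; determinacy of [evals] makes
   the choice of [a] immaterial. *)
have /choice[h Hh] st' : exists d', (exists a, st' = G a) ->
    exists t, evals t c2 st' d'.
  have [[a ->]|no] := pselect (exists a, st' = G a); last by exists (Ret st').
  by have [t2 [d2 E _]] := H2 a; exists d2 => _; exists t2.
have [|t2 E2] := @always_evals c2 h (bind d (fun a => Ret (G a))).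
  by apply/always_bind/always_true => a; apply: Hh; exists a.
exists (t + t2)%N; eexists; first exact: evals_cat H1 E2.
rewrite !bindA /=; apply: eq_bind => a.
have [t3 [d3 E3 <-]] := H2 a.
by have [t4 E4] := Hh (G a) (ex_intro _ a erefl); rewrite (evals_uniq E4 E3).
Qed.

Lemma outputs_nil (st : store) (w : bits) :
  st 0%N = w -> outputs [::] st (Ret w).
Proof. by move=> <-; exists 0%N; exists (Ret st). Qed.

Lemma outputs_step (t : nat) (c1 c2 : seq instr) (st st' : store) (D : dist bits) :
  evals t c1 st (Ret st') -> outputs c2 st' D -> outputs (c1 ++ c2) st D.
Proof.
move=> H1 H2.
exact: (@outputs_cat unit t c1 c2 st (Ret tt) (fun=> st') (fun=> D)).
Qed.

Lemma outputs_drain (x : nat) (f : bool -> seq (nat * bool)) (c : seq instr)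
    (st : store) (D : dist bits) :
  avoids x f -> outputs c (drained x f st) D -> outputs (drain x f ++ c) st D.
Proof.
move=> fx; apply: outputs_step.
apply: (evals_drain (c := (size (f true) + size (f false))%N)) => //.
by case; lia.
Qed.

Lemma outputs_ppt (M : ppt) (code : seq instr) (inputs : seq bits) (D : dist bits) :
  ppt_code M = code -> outputs code (nth [::] inputs) D -> output M inputs = D.
Proof.
move=> <- [t [d E <-]]; rewrite /output; congr bind.
by have [t' E'] := evals_exec M inputs; apply: evals_uniq E' E.
Qed.

Lemma drainedE (x y : nat) (f : bool -> seq (nat * bool)) (g : bool -> bits)
    (st : store) :
  (forall b, [seq yb.2 | yb <- f b & yb.1 == y] = g b) ->
  drained x f st y = rev (flatten (map g (st x))) ++ (if y == x then [::] else st y).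
Proof.
move=> fg; rewrite /drained putE; congr (rev _ ++ _).
rewrite filter_flatten map_flatten -!map_comp; congr flatten.
by apply: eq_map => b /=; rewrite fg.
Qed.

Lemma drained_id (x y : nat) (f : bool -> seq (nat * bool)) (st : store) :
  (forall b, y \notin map fst (f b)) ->
  drained x f st y = if y == x then [::] else st y.
Proof.
move=> fy; rewrite (@drainedE x y f (fun=> [::])) => [|b].
  by rewrite (_ : flatten _ = [::])//; elim: (st x).
rewrite (_ : filter _ _ = [::])//; apply/eqP.
rewrite -size_eq0 size_filter -leqn0 leqNgt -has_count.
by apply/hasP => -[yb ybl /eqP ybx]; case/negP: (fy b); rewrite -ybx map_f.
Qed.

Lemma drained_move (x y : nat) (f : bool -> seq (nat * bool)) (st : store) :
  y != x -> (forall b, [seq yb.2 | yb <- f b & yb.1 == y] = [:: b]) ->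
  drained x f st y = rev (st x) ++ st y.
Proof.
move=> yx fg; rewrite (drainedE _ _ fg) (negbTE yx); congr (rev _ ++ _).
by elim: (st x) => //= b s ->.
Qed.

(** * Sending queries to fixed positions *)

(* A request is [(id, n, L, i)]: row [i] of database [id], of [n] rows of length
   [L]. *)
Definition request : Type := nat * nat * nat * nat.

Definition message (Pi : pir_scheme) (lam : nat) (r : request) : dist (nat * bits) :=
  bind (query_message Pi lam r.1.1.2 r.1.2 r.2) (fun q => Ret (r.1.1.1, q)).

Fixpoint transcript (Pi : pir_scheme) (lam : nat) (rs : seq request) : dist view :=
  if rs is r :: rs'
  then bind (message Pi lam r) (fun m =>
       bind (transcript Pi lam rs') (fun v => Ret (m :: v)))
  else Ret [::].

Lemma transcript_cat (Pi : pir_scheme) (lam : nat) (rs1 rs2 : seq request) :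
  transcript Pi lam (rs1 ++ rs2) =
  bind (transcript Pi lam rs1) (fun v1 =>
  bind (transcript Pi lam rs2) (fun v2 => Ret (v1 ++ v2))).
Proof.
elim: rs1 => [|r rs1 IH] /=; first by rewrite bind_Ret.
rewrite [RHS]bindA IH; apply: eq_bind => m; rewrite !bindA; apply: eq_bind => v1.
by rewrite !bindA.
Qed.

Lemma messageE (Pi : pir_scheme) (lam : nat) (r : request) :
  message Pi lam r =
  bind (exec (pir_Query Pi)
             [:: unary lam; unary r.1.1.2; unary r.1.2; unary r.2])
       (fun st => Ret (r.1.1.1, st 0%N)).
Proof. by rewrite /message /query_message /Query !bindA. Qed.

(* Slots 0 and 1 hold the inputs, 2 is scratch space, 3 accumulates the reversed
   view, 4 is for the distinguisher and each query gets a fresh slot from 5 on. *)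
Notation lam_stack := (reg 0 0).
Notation challenge_stack := (reg 1 0).
Notation tmp_stack := (reg 2 0).
Notation acc_stack := (reg 3 0).

Definition on_stack (y : nat) (s : bits) : seq (nat * bool) := [seq (y, b) | b <- s].

Lemma filter_on_stack (y z : nat) (s : bits) :
  [seq yb.2 | yb <- on_stack y s & yb.1 == z] = if y == z then s else [::].
Proof. by elim: s => /= [|b s]; case: eqP => //= _ ->. Qed.

(** The accumulator is reversed, so the code of the message is pushed in reading order: the number
    in unary, a separator, each bit preceded by [true], and the closing [false]. *)
Definition code_emit (j id : nat) : seq instr :=
  code_put (on_stack acc_stack (rcons (unary id) false)) ++
  drain (reg j 0) (fun b => [:: (acc_stack, true); (acc_stack, b)]) ++
  code_put [:: (acc_stack, false)].

(** Draining destroys its source, so the security parameter is copied by way of the scratch stack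
    and then restored; being unary, it survives the reversals. The other three inputs are constants
    of the program. *)
Definition code_query (Pi : pir_scheme) (j : nat) (r : request) : seq instr :=
  drain lam_stack (fun b => [:: (tmp_stack, b); (reg j 0, b)]) ++
  drain tmp_stack (fun b => [:: (lam_stack, b)]) ++
  code_put (on_stack (reg j 1) (unary r.1.1.2) ++
            on_stack (reg j 2) (unary r.1.2) ++
            on_stack (reg j 3) (unary r.2)) ++
  map (ren j) (ppt_code (pir_Query Pi)).

Arguments code_emit : simpl never.
Arguments code_query : simpl never.

Fixpoint code_send (Pi : pir_scheme) (j : nat) (rs : seq request) : seq instr :=
  if rs is r :: rs'
  then code_query Pi j r ++ code_emit j r.1.1.1 ++ code_send Pi j.+1 rs'
  else [::].

(** Invariant between two requests, with [x] the pending challenge, [w] the encoded view so far and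
    [k] the next fresh slot. *)
Record ready (k lam : nat) (x w : bits) (st : store) : Prop := Ready {
  ready_lam : st lam_stack = unary lam;
  ready_challenge : st challenge_stack = x;
  ready_tmp : st tmp_stack = [::];
  ready_acc : st acc_stack = rev w;
  ready_dist : forall y, st (reg 4 y) = [::];
  ready_fresh : forall j y, (k <= j)%N -> st (reg j y) = [::]
}.

Lemma outputs_emit (j id : nat) (c : seq instr) (st : store) (D : dist bits) :
  j != 3%N ->
  (forall st', st' (reg j 0) = [::] ->
     st' acc_stack = rev (encode_message (id, st (reg j 0))) ++ st acc_stack ->
     (forall i y, (i, y) != (j, 0%N) -> (i, y) != (3, 0)%N ->
        st' (reg i y) = st (reg i y)) ->
     outputs c st' D) ->
  outputs (code_emit j id ++ c) st D.
Proof.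
move=> j3 H; rewrite /code_emit -!catA; apply: outputs_step (evals_put _ _) _.
set s1 := put _ _.
have s1E z : s1 z = (if acc_stack == z then rev (rcons (unary id) false) else [::]) ++ st z.
  by rewrite /s1 putE filter_on_stack; case: eqP.
apply: outputs_drain.
  by move=> b; rewrite /= ?inE ?reg_eq (negbTE j3).
set s2 := drained _ _ _; apply: outputs_step (evals_put _ _) _; apply: H.
- by rewrite putE /= reg_eq (eq_sym 3%N) (negbTE j3) /s2 drained_id ?eqxx// => b;
    rewrite /= ?inE ?reg_eq (negbTE j3).
- rewrite putE /= ?eqxx /= /s2 (@drainedE _ _ _ (fun b => [:: true; b])); last first.
    by move=> b; rewrite /= ?eqxx.
  rewrite reg_eq (eq_sym 3%N) (negbTE j3) /= !s1E eqxx reg_eq (eq_sym 3%N) (negbTE j3) /=.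
  by rewrite /encode_message -cat_rcons !rev_cat -!catA.
- move=> i y; rewrite !xpair_eqE => /negbTE ij /negbTE i3.
  have i3' : (acc_stack == reg i y) = false by rewrite eq_sym reg_eq i3.
  rewrite putE /= i3' /s2 drained_id => [|b].
    by rewrite reg_eq ij s1E i3'.
  by rewrite /= ?inE ?reg_eq i3.
Qed.

Lemma outputs_query (Pi : pir_scheme) (k lam : nat) (x w : bits) (r : request)
    (c : seq instr) (st : store) (f : nat * bits -> dist bits) :
  (4 < k)%N -> ready k lam x w st ->
  (forall m st', ready k.+1 lam x (w ++ encode_message m) st' -> outputs c st' (f m)) ->
  outputs (code_query Pi k r ++ code_emit k r.1.1.1 ++ c) st
          (bind (message Pi lam r) f).
Proof.
move=> k4 [st0 st1 st2 st3 st4 stk] H; rewrite /code_query -3!catA.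
have kE : [/\ (k == 0) = false, (k == 1) = false, (k == 2) = false,
              (k == 3) = false & (k == 4) = false]%N.
  by split; apply/eqP; lia.
have [k0 k1 k2 k3 k4'] := kE; have sk := fun n => eq_sym n k.
apply: outputs_drain; first by move=> b; rewrite /= ?inE ?reg_eq sk k0.
set s1 := drained _ _ _.
have s1E i y : (i, y) != (0, 0)%N -> (i, y) != (2, 0)%N -> (i, y) != (k, 0)%N ->
    s1 (reg i y) = st (reg i y).
  rewrite /s1 !xpair_eqE => i0 i2 ik; rewrite drained_id => [|b].
    by rewrite reg_eq (negbTE i0).
  by rewrite /= ?inE ?reg_eq negb_or i2 ik.
have s1_0 : s1 lam_stack = [::].
  by rewrite /s1 drained_id ?eqxx// => b; rewrite /= ?inE ?reg_eq sk k0.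
have s1_2 : s1 tmp_stack = unary lam.
  rewrite /s1 drained_move ?reg_eq// ?st0 ?st2 ?cats0 ?rev_nseq// => b.
  by rewrite /= ?eqxx reg_eq k2.
have s1_k : s1 (reg k 0) = unary lam.
  rewrite /s1 drained_move ?reg_eq ?k0// ?st0 ?stk// ?cats0 ?rev_nseq// => b.
  by rewrite /= ?eqxx reg_eq sk k2.
apply: outputs_drain; first by move=> b; rewrite /= ?inE ?reg_eq.
set s2 := drained _ _ _.
have s2E i y : (i, y) != (0, 0)%N -> (i, y) != (2, 0)%N -> s2 (reg i y) = s1 (reg i y).
  rewrite /s2 !xpair_eqE => i0 i2; rewrite drained_id => [|b].
    by rewrite reg_eq (negbTE i2).
  by rewrite /= ?inE ?reg_eq.
have s2_0 : s2 lam_stack = unary lam.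
  rewrite /s2 drained_move ?reg_eq// ?s1_0 ?s1_2 ?cats0 ?rev_nseq// => b.
have s2_2 : s2 tmp_stack = [::].
  by rewrite /s2 drained_id ?eqxx// => b; rewrite /= ?inE ?reg_eq.
apply: outputs_step (evals_put _ _) _; set s3 := put _ _.
have s3E i y : i != k -> s3 (reg i y) = s2 (reg i y).
  move=> ik; rewrite /s3 putE !filter_cat !map_cat !filter_on_stack !reg_eq.
  by rewrite eq_sym (negbTE ik).
have s3k : (fun y => s3 (reg k y)) =
    nth [::] [:: unary lam; unary r.1.1.2; unary r.1.2; unary r.2].
  apply: funext => y; rewrite /s3 putE !filter_cat !map_cat !filter_on_stack !reg_eq eqxx /=.
  have [->|y0] := eqVneq y 0%N.
    by rewrite s2E ?xpair_eqE ?k0 ?k2.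
  rewrite s2E ?s1E ?stk ?xpair_eqE ?k0 ?k2 ?(negbTE y0) ?andbF// cats0.
  by case: y y0 => [|[|[|[|y]]]] //= _; rewrite ?cats0 ?rev_nseq// nth_nil.
have [t E] := evals_exec (pir_Query Pi)
  [:: unary lam; unary r.1.1.2; unary r.1.2; unary r.2].
rewrite -s3k in E; rewrite messageE bindA.
apply: outputs_cat (evals_ren E) _ => stq.
apply: outputs_emit => [|st' st'k st'3 st'E]; first by rewrite k3.
apply: H; split.
- by rewrite st'E ?xpair_eqE ?sk ?k0// mergeE sk k0 s3E ?sk ?k0.
- by rewrite st'E ?xpair_eqE ?sk ?k1// mergeE sk k1 s3E ?sk ?k1 ?s2E ?s1E// xpair_eqE sk k1.
- by rewrite st'E ?xpair_eqE ?sk ?k2// mergeE sk k2 s3E ?sk ?k2.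
- rewrite st'3 !mergeE eqxx sk k3 s3E ?sk ?k3// s2E// s1E ?xpair_eqE ?sk ?k3// st3.
  by rewrite rev_cat.
- by move=> y; rewrite st'E ?xpair_eqE ?sk ?k4'// mergeE sk k4' s3E ?sk ?k4' ?s2E ?s1E//
    ?xpair_eqE ?sk ?k4'.
- move=> j y kj.
  have jE : [/\ (j == 0) = false, (j == 2) = false, (j == 3) = false
              & (j == k) = false]%N by split; apply/eqP; lia.
  have [j0 j2 j3 jk] := jE.
  rewrite st'E ?xpair_eqE ?jk ?j3// mergeE jk s3E ?jk//.
  by rewrite s2E ?s1E ?xpair_eqE ?j0 ?j2 ?jk// stk// ltnW.
Qed.

Lemma outputs_send (Pi : pir_scheme) (rs : seq request) (k lam : nat) (x w : bits)
    (c : seq instr) (st : store) (f : view -> dist bits) :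
  (4 < k)%N -> ready k lam x w st ->
  (forall v st', ready (k + size rs) lam x (w ++ encode_view v) st' ->
     outputs c st' (f v)) ->
  outputs (code_send Pi k rs ++ c) st (bind (transcript Pi lam rs) f).
Proof.
elim: rs k w st f => [|r rs IH] k w st f k4 rst H.
  by apply: H; rewrite addn0 /encode_view /= cats0.
have -> : code_send Pi k (r :: rs) ++ c =
    code_query Pi k r ++ code_emit k r.1.1.1 ++ code_send Pi k.+1 rs ++ c.
  by rewrite /= -!catA.
rewrite [transcript _ _ _]/(bind _ _) bindA.
have k_gt4 := k4; apply: outputs_query k_gt4 rst _ => m st' rst'; rewrite bindA.
apply: (IH _ _ _ _ _ rst')  => [|v st'' rst'']; first exact: leqW.
by apply: H; rewrite /= addnS -addSn /encode_view /= catA.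
Qed.

(** The challenge of the reduction is emitted as if it were the output of a query run in slot 1. *)
Lemma outputs_forward (k lam id : nat) (x w : bits) (c : seq instr) (st : store)
    (D : dist bits) :
  (4 < k)%N -> ready k lam x w st ->
  (forall st', ready k lam [::] (w ++ encode_message (id, x)) st' -> outputs c st' D) ->
  outputs (code_emit 1 id ++ c) st D.
Proof.
move=> k4 [st0 st1 st2 st3 st4 stk] H.
apply: outputs_emit => // st' st'1 st'3 st'E; apply: H; split => //.
- by rewrite st'E.
- by rewrite st'E.
- by rewrite st'3 st1 st3 rev_cat.
- by move=> y; rewrite st'E.
- by move=> j y kj; rewrite st'E ?xpair_eqE ?stk//; apply/nandP; left; lia.
Qed.

Lemma reg_gt1 (j x : nat) : (j, x) != (0, 0)%N -> (j, x) != (1, 0)%N -> (1 < reg j x)%N.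
Proof.
rewrite !xpair_eqE /reg; case: j => [|[|j]] /=; lia.
Qed.

Lemma ready_initial (lam : nat) (x : bits) :
  ready 5 lam x [::] (nth [::] [:: unary lam; x]).
Proof.
have E j y : (j, y) != (0, 0)%N -> (j, y) != (1, 0)%N ->
    nth [::] [:: unary lam; x] (reg j y) = [::].
  by move=> j0 j1; rewrite nth_default//; apply: reg_gt1.
split => // j y j5.
rewrite E ?xpair_eqE//; apply/nandP; left; lia.
Qed.

Lemma ready_initial1 (lam : nat) : ready 5 lam [::] [::] (nth [::] [:: unary lam]).
Proof.
suff -> : nth [::] [:: unary lam] = nth [::] [:: unary lam; [::]].
  exact: ready_initial.
by apply: funext => -[|[|y]] //=; rewrite nth_nil.
Qed.

(** Stack 0 holds the security parameter and is also the output, hence it is emptied first; draining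
    the accumulator undoes its reversal. *)
Definition code_return : seq instr :=
  drain lam_stack (fun=> [::]) ++
  drain acc_stack (fun b => [:: (lam_stack, b)]).

Lemma outputs_return (k lam : nat) (x w : bits) (st : store) :
  ready k lam x w st -> outputs code_return st (Ret w).
Proof.
move=> [st0 st1 st2 st3 st4 stk]; rewrite /code_return.
apply: outputs_drain => //; rewrite -[drain _ _]cats0.
apply: outputs_drain => //; apply: outputs_nil.
by rewrite -[0%N]/lam_stack drained_move// !drained_id// st3 revK eqxx cats0.
Qed.

(** Draining the accumulator into slot 4 puts the view in reading order. The verdict is moved twice,
    so that it reaches stack 0 unreversed. *)
Definition code_distinguish (D : ppt) : seq instr :=
  drain lam_stack (fun b => [:: (reg 4 0, b)]) ++
  drain acc_stack (fun b => [:: (reg 4 1, b)]) ++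
  map (ren 4) (ppt_code D) ++
  drain (reg 4 0) (fun b => [:: (tmp_stack, b)]) ++
  drain tmp_stack (fun b => [:: (lam_stack, b)]).

Lemma outputs_distinguish (D : ppt) (k lam : nat) (x w : bits) (st : store) :
  ready k lam x w st ->
  outputs (code_distinguish D) st (output D [:: unary lam; w]).
Proof.
move=> [st0 st1 st2 st3 st4 stk]; rewrite /code_distinguish.
apply: outputs_drain => //; set s1 := drained _ _ _.
apply: outputs_drain => //; set s2 := drained _ _ _.
have s2_0 : s2 lam_stack = [::] by rewrite /s2 /s1 !drained_id.
have s2_2 : s2 tmp_stack = [::] by rewrite /s2 /s1 !drained_id.
have s2_4 : (fun y => s2 (reg 4 y)) = nth [::] [:: unary lam; w].
  apply: funext => y; rewrite /s2 /s1; case: y => [|[|y]] /=.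
  - by rewrite drained_id// drained_move// st0 st4 cats0 rev_nseq.
  - by rewrite drained_move// !drained_id// st3 revK st4 cats0.
  - by rewrite !drained_id ?st4 ?nth_nil ?reg_eq// => b; rewrite inE reg_eq.
have [t E] := evals_exec D [:: unary lam; w]; rewrite -s2_4 in E.
rewrite /output; apply: outputs_cat (evals_ren E) _ => std.
apply: outputs_drain => //; rewrite -[drain tmp_stack _]cats0.
apply: outputs_drain => //; apply: outputs_nil.
rewrite -[0%N]/lam_stack drained_move// drained_move//.
rewrite drained_id// !mergeE /= s2_0 s2_2.
by rewrite !cats0 revK.
Qed.

(** * Polynomial running time, the simulator and the reduction *)

Lemma avoids_reg (i x : nat) (f : bool -> seq (nat * bool)) :
  all (fun y => y != reg i x) (map fst (f true) ++ map fst (f false)) ->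
  avoids (reg i x) f.
Proof.
rewrite all_cat => /andP[/allP H1 /allP H2] b.
by apply/negP; case: b => [/H1|/H2]; rewrite eqxx.
Qed.

Lemma polytime_emit (j id : nat) : j != 3%N -> polytime (code_emit j id).
Proof.
move=> j3; do ?apply: polytime_cat; try exact: polytime_put.
by apply/polytime_drain/avoids_reg; rewrite /= !reg_eq eq_sym (negbTE j3).
Qed.

Lemma polytime_send (Pi : pir_scheme) (k : nat) (rs : seq request) :
  (4 < k)%N -> polytime (code_send Pi k rs).
Proof.
elim: rs k => [|r rs IH] k k4; first exact: (polytime_put [::]).
have kE : (0 == k)%N = false /\ k != 3%N by split; [apply/eqP; lia|lia].
have [k0 k3] := kE.
apply: polytime_cat; last by apply: polytime_cat; [apply: polytime_emit|apply/IH/leqW].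
apply: polytime_cat; first by apply/polytime_drain/avoids_reg; rewrite /= !reg_eq eq_sym k0.
apply: polytime_cat; first exact/polytime_drain/avoids_reg.
apply: polytime_cat; first exact: polytime_put.
exact/polytime_ren/polytime_ppt_code.
Qed.

Lemma simulator (Pi : pir_scheme) (rs : seq request) :
  exists Sim : ppt, forall lam,
    output Sim [:: unary lam] =
    bind (transcript Pi lam rs) (fun v => Ret (encode_view v)).
Proof.
have [|Sim SimE] := @ppt_of_polytime (code_send Pi 5 rs ++ code_return).
  apply: polytime_cat; first exact: polytime_send.
  by apply: polytime_cat; apply/polytime_drain/avoids_reg.
exists Sim => lam; apply: outputs_ppt SimE _.
apply: outputs_send (ready_initial1 lam) _ => // v st' rst'.
exact: outputs_return rst'.
Qed.

(** The requests around the challenge are written into the code of [D']; they do not depend on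
    [lam], so one program serves all security parameters. *)
Lemma reduction (Pi : pir_scheme) (D : ppt) (pre suf : seq request) (id : nat) :
  exists D' : ppt, forall lam x,
    output D' [:: unary lam; x] =
    bind (transcript Pi lam pre) (fun v1 =>
    bind (transcript Pi lam suf) (fun v2 =>
    output D [:: unary lam; encode_view (v1 ++ (id, x) :: v2)])).
Proof.
have [|D' D'E] := @ppt_of_polytime (code_send Pi 5 pre ++ code_emit 1 id ++
    code_send Pi (5 + size pre) suf ++ code_distinguish D).
  apply: polytime_cat; first exact: polytime_send.
  apply: polytime_cat; first exact: polytime_emit.
  apply: polytime_cat; first by apply: polytime_send; rewrite addSn.
  do 2 (apply: polytime_cat; first exact/polytime_drain/avoids_reg).
  apply: polytime_cat; first exact/polytime_ren/polytime_ppt_code.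
  by apply: polytime_cat; apply/polytime_drain/avoids_reg.
exists D' => lam x; apply: outputs_ppt D'E _.
apply: outputs_send (ready_initial lam x) _ => // v1 s1 r1.
apply: outputs_forward r1 _ => [|s2 r2]; first by rewrite addSn.
apply: outputs_send r2 _ => [|v2 s3 r3]; first by rewrite addSn.
rewrite /encode_view map_cat flatten_cat /= catA -/(encode_view v1).
exact: outputs_distinguish r3.
Qed.

(** * Hybrid argument *)

Section Hybrid.
Variables (R : realType) (Pi : pir_scheme).

Definition accepts (D : ppt) (lam : nat) (v : view) : R :=
  Pr R (fun o => o == [:: true]) (output D [:: unary lam; encode_view v]).

Definition idle (plan : seq (nat * nat * nat)) : seq request :=
  [seq (e, 0%N) | e <- plan].

Definition in_range (r : request) : bool := (r.2 < r.1.1.2)%N.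

Lemma Pr_accept_reduction (D : ppt) (pre suf : seq request) (id : nat) :
  exists D' : ppt, forall lam n L i,
    Pr_accept R D' lam (query_message Pi lam n L i) =
    Ex (accepts D lam) (transcript Pi lam (pre ++ (id, n, L, i) :: suf)).
Proof.
have [D' D'E] := reduction Pi D pre suf id; exists D' => lam n L i.
rewrite /Pr_accept Pr_bind transcript_cat [RHS]Ex_bind.
transitivity (Ex (fun q => Ex (fun v1 => Ex (fun v2 =>
    accepts D lam (v1 ++ (id, q) :: v2)) (transcript Pi lam suf))
    (transcript Pi lam pre)) (query_message Pi lam n L i)).
  apply: eq_Ex => q; rewrite D'E Pr_bind; apply: eq_Ex => v1.
  by rewrite Pr_bind.
rewrite Ex_swap; apply: eq_Ex => v1.
rewrite !Ex_bind; apply: eq_Ex => q /=.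
by rewrite !Ex_bind.
Qed.

(** Induction on the plan, from the front. With the actual head kept in the prefix, the tail is made
    idle by induction; then the head is moved to position 0 by privacy. *)
Lemma hybrid (D : ppt) : pir_private R Pi ->
  forall plan pre, exists2 nu : nat -> R, negligible nu &
    forall lam rs, map fst rs = plan -> all in_range rs ->
      `|Ex (accepts D lam) (transcript Pi lam (pre ++ rs))
        - Ex (accepts D lam) (transcript Pi lam (pre ++ idle plan))| <= nu lam.
Proof.
move=> private; elim=> [|[[id n] L] plan IH] pre.
  exists (fun=> 0); first exact: negligible0.
  by move=> lam [|//] _ _; rewrite subrr normr0.
have [D' D'E] := Pr_accept_reduction D pre (idle plan) id.
(* Positions out of range get the zero function, so that [choice] yields a family indexed by all
   naturals. *)
have /choice[mu muP] i : exists mu : nat -> R, negligible mu /\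
    ((i < n)%N -> forall lam,
      `|Pr_accept R D' lam (query_message Pi lam n L i)
        - Pr_accept R D' lam (query_message Pi lam n L 0)| <= mu lam).
  have [i_n|_] := boolP (i < n)%N; last by exists (fun=> 0); split=> //; apply: negligible0.
  by have [mu [? ?]] := private n L i 0%N D' i_n (leq_ltn_trans (leq0n i) i_n); exists mu.
have /choice[nu nuP] i : exists nu : nat -> R, negligible nu /\
    forall lam rs, map fst rs = plan -> all in_range rs ->
      `|Ex (accepts D lam) (transcript Pi lam ((pre ++ [:: (id, n, L, i)]) ++ rs))
        - Ex (accepts D lam)
             (transcript Pi lam ((pre ++ [:: (id, n, L, i)]) ++ idle plan))| <= nu lam.
  by have [nu ? ?] := IH (pre ++ [:: (id, n, L, i)]); exists nu.
(* Summing over every possible head position makes the bound independent of [rs]; absolute values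
   let the sum dominate the term of the actual position. *)
exists (fun lam => \sum_(i <- iota 0 n) (`|nu i lam| + `|mu i lam|)).
  apply: negligible_sum => i; apply: negligibleD; apply: negligible_norm.
    by case: (nuP i).
  by case: (muP i).
move=> lam [//|[e i] rs] [-> rsE] /andP[]; rewrite /in_range /= => i_n rs_ok.
have [_ /(_ i_n lam)] := muP i; rewrite !D'E => mu_i.
have [_ /(_ lam rs rsE rs_ok)] := nuP i; rewrite -!catA /= => nu_i.
rewrite (bigD1_seq i) ?mem_iota ?iota_uniq//=.
apply: le_trans (ler_distD _ _ _) (le_trans (lerD nu_i mu_i) _).
apply: le_trans (lerD (ler_norm _) (ler_norm _)) _.
by rewrite lerDl sumr_ge0// => j _; rewrite addr_ge0.
Qed.

End Hybrid.

(** * Correctness makes the requested positions deterministic *)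

Section Ideal.
Variables (R : realType) (Pi : pir_scheme) (lam : nat) (e : R).

(* Up to an error [e] for each request, [m] sends the requests [rs] and
   returns [a]. *)
Definition ideal (A : Type) (m : session A) (rs : seq request) (a : A) : Prop :=
  close (e *+ size rs) m (bind (transcript Pi lam rs) (fun v => Ret (v, a))).

Lemma ideal_ret (A : Type) (a : A) : ideal (sret a) [::] a.
Proof. exact: close_refl. Qed.

(** Once [m] is replaced by its ideal version, its result is always [a], so the continuation is
    needed at [a] only. *)
Lemma ideal_bind (A B : Type) (m : session A) (f : A -> session B)
    (rs rs' : seq request) (a : A) (b : B) :
  ideal m rs a -> ideal (f a) rs' b -> ideal (sbind m f) (rs ++ rs') b.
Proof.
move=> Hm Hf g tg; rewrite size_cat mulrnDr.
set k := fun va : view * A => bind (f va.2) (fun vb => Ret (va.1 ++ vb.1, vb.2)).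
apply: le_trans (ler_distD (Ex g (bind (bind (transcript Pi lam rs)
  (fun v => Ret (v, a))) k)) _ _) _.
apply: lerD.
  by have := close_bind Hm (fun va => @close_refl R _ (k va)) tg; rewrite addr0.
set k' := fun v => bind (transcript Pi lam rs') (fun v' => Ret (v ++ v', b)).
have Hk v : close (e *+ size rs') (k (v, a)) (k' v).
  rewrite -[e *+ _]addr0.
  have -> : k' v = bind (bind (transcript Pi lam rs') (fun v' => Ret (v', b)))
      (fun vb => Ret (v ++ vb.1, vb.2)) by rewrite bindA.
  exact: close_bind Hf (fun vb => @close_refl R _ _).
have := close_bind (@close_refl R _ (transcript Pi lam rs)) Hk tg.
have -> : bind (transcript Pi lam (rs ++ rs')) (fun v => Ret (v, b)) =
    bind (transcript Pi lam rs) k'.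
  by rewrite transcript_cat bindA; apply: eq_bind => v; rewrite bindA.
by rewrite add0r bindA.
Qed.

Lemma ideal_traverse (A : eqType) (B : Type) (f : A -> session B)
    (rs : A -> seq request) (h : A -> B) (s : seq A) :
  (forall x, x \in s -> ideal (f x) (rs x) (h x)) ->
  ideal (traverse f s) (flatten (map rs s)) (map h s).
Proof.
elim: s => [|x s IH] H; first exact: ideal_ret.
rewrite /= -[flatten (map rs s)]cats0.
apply: ideal_bind; first by apply: H; rewrite mem_head.
apply: ideal_bind; last exact: ideal_ret.
by apply: IH => y ys; apply: H; rewrite inE ys orbT.
Qed.

(** The message has exactly the right distribution; the error comes only from the decoded row. *)
Lemma ideal_fetch (T : eqType) (id : nat) (c : codec T) (rows : seq T) (i : nat) (x0 : T) :
  lossless c rows -> (i < size rows)%N ->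
  Pr R (fun o => o.2 == nth [::] (map (enc c) rows) i)
     (retrieve Pi lam (width c) (map (enc c) rows) i) >= 1 - e ->
  ideal (fetch Pi lam id c rows i) [:: (id, size rows, width c, i)] (nth x0 rows i).
Proof.
move=> cK i_rows correct g tg; rewrite mulr1n /fetch.
set d := retrieve _ _ _ _ _ in correct *.
(* The ideal experiment is put on the coins of the real one, by also running [Answer] and [Decode]
   and discarding the result. *)
have -> : Ex g (bind (transcript Pi lam [:: (id, size rows, width c, i)])
      (fun v => Ret (v, nth x0 rows i))) =
    Ex (fun qx => g ([:: (id, qx.1)], nth x0 rows i)) d.
  transitivity (Ex (fun qs : bits * bits => g ([:: (id, qs.1)], nth x0 rows i))
      (Query Pi lam (size rows) (width c) i)).
    suff H Q : Ex g (bind (bind (bind (bind Q (fun qs : bits * bits => Ret qs.1))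
        (fun q => Ret (id, q))) (fun msg => bind (Ret [::]) (fun v => Ret (msg :: v))))
        (fun v => Ret (v, nth x0 rows i))) =
        Ex (fun qs => g ([:: (id, qs.1)], nth x0 rows i)) Q by exact: H.
    by rewrite !bindA Ex_bind.
  rewrite /d /retrieve size_map Ex_bind; apply: eq_Ex => qs.
  rewrite Ex_bind -[LHS](Ex_cst _ (Answer Pi lam (width c) (map (enc c) rows) qs.1)).
  by apply: eq_Ex => a; rewrite Ex_bind /= Ex_cst.
rewrite Ex_bind /= -ExB; apply: le_trans (norm_Ex _ _) _.
rewrite (nth_map x0) // in correct.
(* The two integrands agree when decoding succeeds and differ by at most 1 otherwise. *)
apply: le_trans (_ : Ex (fun o => 1 - (o.2 == enc c (nth x0 rows i))%:R) d <= _).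
  apply: le_Ex => -[q x] /=; case: eqP => [->|_].
    by have [_ ->] := cK _ (mem_nth x0 i_rows); rewrite !subrr normr0.
  rewrite subr0 ler_norml; have /andP[? ?] := tg ([:: (id, q)], dec c x).
  by have /andP[? ?] := tg ([:: (id, q)], nth x0 rows i); apply/andP; split; lra.
by rewrite ExB Ex_cst -Pr_Ex; lra.
Qed.

End Ideal.

(** * Selecting the best items, and families of lists that partition an interval *)

Lemma top_map (R : realType) (T : Type) (n : nat) (s : seq (T * R)) :
  top n s = take n (map fst (sort (fun x y : T * R => y.2 <= x.2) s)).
Proof. by rewrite /top map_take. Qed.

Lemma size_top (R : realType) (T : Type) (n : nat) (s : seq (T * R)) :
  (n <= size s)%N -> size (top n s) = n.
Proof. by move=> ns; rewrite top_map size_takel// size_map size_sort. Qed.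

Lemma top_subset (R : realType) (T : eqType) (n : nat) (s : seq (T * R)) :
  {subset top n s <= map fst s}.
Proof.
move=> x; rewrite top_map => /mem_take.
by rewrite (perm_mem (perm_map fst (permEl (perm_sort _ s)))).
Qed.

Lemma top_uniq (R : realType) (T : eqType) (n : nat) (s : seq (T * R)) :
  uniq (map fst s) -> uniq (top n s).
Proof.
move=> us; rewrite top_map take_uniq//.
by rewrite (perm_uniq (perm_map fst (permEl (perm_sort _ s)))).
Qed.

(** Adding the lists of the indices outside [F] gives a permutation of the whole interval; freedom
    from duplicates and the range are inherited by the part that comes from [F]. *)
Lemma sub_partition (f : nat -> seq nat) (n m : nat) (F : seq nat) :
  perm_eq (flatten [seq f b | b <- iota 0 n]) (iota 0 m) ->
  uniq F -> all (fun b => b < n)%N F ->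
  [/\ uniq (flatten (map f F)), all (fun c => c < m)%N (flatten (map f F)) &
      size F = n -> size (flatten (map f F)) = m].
Proof.
move=> fP uF /allP Fn.
have FP : perm_eq F (filter [in F] (iota 0 n)).
  apply: uniq_perm; rewrite ?filter_uniq ?iota_uniq// => b.
  by rewrite mem_filter mem_iota add0n /=; case: (boolP (b \in F)) => // /Fn ->.
have E : perm_eq (flatten (map f F) ++
    flatten (map f (filter (predC [in F]) (iota 0 n)))) (iota 0 m).
  rewrite -flatten_cat -map_cat; apply: perm_trans fP.
  apply/perm_flatten/perm_map; apply: perm_trans (permEl (perm_filterC [in F] _)).
  by rewrite perm_cat2r.
split.
- by have := perm_uniq E; rewrite iota_uniq cat_uniq => /andP[].
- by apply/allP => c cF; have := perm_mem E c; rewrite mem_iota mem_cat cF /= add0n.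
- move=> sF; rewrite -[RHS](size_iota 0) -(perm_size fP); apply: perm_size.
  apply/perm_flatten/perm_map; apply: uniq_perm; rewrite ?iota_uniq//.
  apply: (uniq_min_size uF _ _).2; last by rewrite size_iota sF.
  by move=> b /Fn; rewrite mem_iota.
Qed.

(** * The public plan of requests and the ideal run of the client *)

Section Protocol.
Variables (R : realType) (P : params R).
Hypothesis wfP : well_formed P.

Definition lex_endpoint (l : nat) : nat * nat * nat :=
  (l, lex_rows P l, width (lex_codec P l)).

Definition vec_endpoint : nat * nat * nat :=
  ((height P).+1, vec_rows P, width (vec_codec P)).

Definition beam_size (l : nat) : nat := minn (beam P) (nnodes P l).

Definition level_plan (l : nat) : seq (nat * nat * nat) :=
  nseq (nterms P * (beam_size l * nhash P)) (lex_endpoint l).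

Definition descent_plan (h l : nat) : seq (nat * nat * nat) :=
  flatten [seq level_plan k | k <- iota l h].

(** The part of the requests that is the same for every query: database number, number of rows and
    record width, in order of sending, without the positions. *)
Definition plan : seq (nat * nat * nat) :=
  descent_plan (height P).-1 1 ++ level_plan (height P) ++
  nseq (nsub P) vec_endpoint.

Definition frontier (l : nat) (F : seq nat) : Prop :=
  [/\ uniq F, all (fun b => b < nnodes P l)%N F & size F = beam_size l].

Lemma frontier_root : frontier 1 [:: 0%N].
Proof.
have [[_ _ _ _ beam0] [_ [[n1 _ _ _ _] _]]] := wfP.
by split; rewrite //= /beam_size ?n1//; apply/esym/minn_idPr.
Qed.

Lemma frontier_top (l : nat) (F : seq nat) (s : seq (nat * R)) :
  (0 < l < height P)%N -> frontier l F ->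
  map fst s = flatten [seq parts P l b | b <- F] ->
  frontier l.+1 (top (beam_size l.+1) s).
Proof.
move=> lP [uF Fl sF] sE; have [_ [_ [[_ _ treeP _ _] _]]] := wfP.
have [childrenP permP] := treeP l lP.
have partsE : parts P l = children P l.
  by apply: funext => b; rewrite /parts; case/andP: lP => _ ->.
rewrite partsE in sE; have [uC Cl sC] := sub_partition permP uF Fl.
split; first by apply: top_uniq; rewrite sE.
  by apply/allP => c /top_subset; rewrite sE => /(allP Cl).
apply: size_top; rewrite -(size_map fst) sE.
(* Every node has at least one child. *)
have le_size : (size F <= size (flatten (map (children P l) F)))%N.
  rewrite size_flatten /shape -map_comp -[X in (X <= _)%N]muln1.
  elim: F Fl {uF sF sE uC Cl sC} => //= b F IH /andP[/childrenP /andP[b1 _] /IH].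
  by rewrite !muln1; lia.
(* If the beam fits in level [l], then [F] has [beam P] nodes, hence at least that many children.
   Otherwise [F] is the whole level and its children are the whole next level. *)
have [beam_le|/ltnW beam_ge] := leqP (beam P) (nnodes P l).
  apply: leq_trans (geq_minl _ _) _; apply: leq_trans le_size.
  by rewrite sF /beam_size (minn_idPl beam_le).
by rewrite sC ?geq_minr// sF /beam_size (minn_idPr beam_ge).
Qed.

Variables (DB : nat -> seq (lex_row R (term P))) (Pi : pir_scheme).
Variables (lam : nat) (e : R) (Q : (nterms P).-tuple (term P)).

Hypothesis size_DB : forall l, (0 < l <= height P)%N -> size (DB l) = lex_rows P l.

Hypothesis ideal_lex : forall l i, (0 < l <= height P)%N -> (i < lex_rows P l)%N ->
  ideal Pi lam e (fetch Pi lam l (lex_codec P l) (DB l) i)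
        [:: (lex_endpoint l, i)] (nth None (DB l) i).

Hypothesis ideal_vec : forall i, (i < vec_rows P)%N ->
  ideal Pi lam e (fetch Pi lam (height P).+1 (vec_codec P) (vec_table P) i)
        [:: (vec_endpoint, i)] (nth [::] (vec_table P) i).

Lemma ideal_rows (T : Type) (f : nat -> session T) (ep : nat * nat * nat)
    (h : nat -> T) (s : seq nat) :
  (forall i, (i < ep.1.2)%N -> ideal Pi lam e (f i) [:: (ep, i)] (h i)) ->
  all (fun i => i < ep.1.2)%N s ->
  ideal Pi lam e (traverse f s) [seq (ep, i) | i <- s] (map h s).
Proof.
move=> H /allP s_ok.
have -> : [seq (ep, i) | i <- s] = flatten [seq [:: (ep, i)] | i <- s].
  by elim: s {s_ok} => //= i s ->.
by apply: ideal_traverse => i /s_ok; apply: H.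
Qed.

(** The query influences only positions and scores: the number of requests follows from the size of
    [F], and the listed parts from [F] itself. *)
Lemma ideal_scored_parts (l : nat) (F : seq nat) :
  (0 < l <= height P)%N -> frontier l F ->
  exists rs s, [/\ ideal Pi lam e (scored_parts DB Pi lam Q l F) rs s,
    map fst rs = level_plan l, all in_range rs &
    map fst s = flatten [seq parts P l b | b <- F]].
Proof.
move=> lP [uF Fl sF]; have [_ [_ [_ [_ [_ [hashP _]]]]]] := wfP.
pose pos w := [seq hash a w l b | b <- F, a <- enum 'I_(nhash P)].
have pos_ok w : all (fun i => i < lex_rows P l)%N (pos w).
  by apply/allP => i /allpairsP[[b a] [/= /(allP Fl) bl _ ->]]; apply: hashP.
pose rs := flatten [seq [seq (lex_endpoint l, i) | i <- pos w] | w <- Q].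
pose got := [seq (w, map (nth None (DB l)) (pos w)) | w <- Q].
exists rs, (flatten [seq [seq (nth 0%N (parts P l b) j,
    \sum_(wr <- got) (matching wr.1 b wr.2)`_j) | j <- iota 0 (size (parts P l b))]
  | b <- F]); split.
- rewrite -[rs]cats0; apply: ideal_bind; last exact: ideal_ret.
  apply: ideal_traverse => w _; rewrite -[map _ (pos w)]cats0.
  apply: ideal_bind; last exact: ideal_ret.
  by apply: ideal_rows => [i|]; [apply: ideal_lex|apply: pos_ok].
- rewrite /rs /level_plan -sF map_flatten -map_comp -[in RHS](size_tuple Q).
  elim: (tval Q) => //= w ws ->; rewrite mulSn nseqD; congr (_ ++ _).
  rewrite -map_comp; have -> : (size F * nhash P)%N = size (pos w).
    by rewrite /pos size_allpairs size_enum_ord.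
  by elim: (pos w) => //= i s ->.
- apply/allP => _ /flattenP[_ /mapP[w _ ->] /mapP[i ip ->]].
  exact: (allP (pos_ok w) i ip).
- rewrite map_flatten -map_comp; congr flatten; apply: eq_map => b /=.
  by rewrite -map_comp map_nth_iota0 ?take_size.
Qed.

Lemma ideal_descend (h l : nat) (F : seq nat) :
  (0 < l)%N -> (l + h = height P)%N -> frontier l F ->
  exists rs F', [/\ ideal Pi lam e (descend DB Pi lam Q h l F) rs F',
    map fst rs = descent_plan h l, all in_range rs & frontier (height P) F'].
Proof.
elim: h l F => [|h IH] l F l0 lh Fl.
  exists [::], F; split => //; first exact: ideal_ret.
  by rewrite -lh addn0.
have lP : (0 < l < height P)%N by rewrite l0 -lh; lia.
have [|rs [s [s_ok rsE rs_ok sE]]] := @ideal_scored_parts l F _ Fl.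
  by rewrite l0 -lh; lia.
have lh' : (l.+1 + h = height P)%N by rewrite addSnnS.
have [rs' [F' [d_ok rs'E rs'_ok F'l]]] :=
  IH l.+1 _ (ltn0Sn l) lh' (frontier_top lP Fl sE).
exists (rs ++ rs'), F'; split => //; first exact: ideal_bind s_ok d_ok.
  by rewrite map_cat rsE rs'E.
by rewrite all_cat rs_ok.
Qed.

Lemma ideal_pillar_tree : exists rs res,
  [/\ ideal Pi lam e (pillar_tree DB Pi lam Q) rs res, map fst rs = plan &
      all in_range rs].
Proof.
have [rs1 [F [ok1 rs1E rs1_ok FH]]] :=
  @ideal_descend (height P).-1 1 [:: 0%N] isT erefl frontier_root.
have [|rs2 [s [ok2 rs2E rs2_ok sE]]] := @ideal_scored_parts (height P) F _ FH.
  by rewrite leqnn.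
have [_ [_ [[_ _ _ _ subsP] [_ [_ [_ nsubP]]]]]] := wfP.
have [uF FN sF] := FH.
have partsE : parts P (height P) = subs P.
  by apply: funext => b; rewrite /parts ltnn.
rewrite partsE in sE; have [_ subs_ok _] := sub_partition subsP uF FN.
pose selected := top (nsub P) s.
have sel_ok : all (fun p => p < vec_rows P)%N selected.
  by apply/allP => p /top_subset; rewrite sE => /(allP subs_ok).
have sel_size : size selected = nsub P.
  apply: size_top; rewrite -(size_map fst) sE size_flatten /shape -map_comp.
  exact: nsubP.
eexists; eexists; split.
- apply: ideal_bind ok1 _; apply: ideal_bind ok2 _; apply: ideal_bind.
    exact: (@ideal_rows _ _ vec_endpoint _ selected ideal_vec).
  exact: ideal_ret.
- rewrite cats0 !map_cat rs1E rs2E -map_comp; congr (_ ++ (_ ++ _)).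
  by rewrite -sel_size; elim: selected {sel_ok sel_size} => //= p ps ->.
- by rewrite cats0 !all_cat rs1_ok rs2_ok all_map.
Qed.

End Protocol.

(** * Combining correctness and privacy into the security bound *)

Theorem theorem3 (R : realType) (Pi : pir_scheme) (P : params R) :
  computationally_private R Pi ->
  well_formed P ->
  secure_against_semi_honest_server Pi P.
Proof.
move=> [correct private] wfP.
have [Sim SimE] := simulator Pi (idle (plan P)).
exists Sim => DB [lexP vecP] D.
have size_DB l : (0 < l <= height P)%N -> size (DB l) = lex_rows P l.
  by move=> /lexP[[]].
have size_vec : size (vec_table P) = vec_rows P by rewrite size_map size_iota.
(* The side conditions are moved behind the existential, so that [choice] gives one error function
   for each table and position. *)
have fetch_error (T : eqType) (c : codec T) (rows : seq T) (i : nat) :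
    exists nu : nat -> R, negligible nu /\
      (lossless c rows -> (i < size rows)%N -> forall lam,
        Pr R (fun o => o.2 == nth [::] (map (enc c) rows) i)
          (retrieve Pi lam (width c) (map (enc c) rows) i) >= 1 - nu lam).
  have [cK|nK] := pselect (lossless c rows); last first.
    by exists (fun=> 0); split=> //; apply: negligible0.
  have [i_rows|_] := boolP (i < size rows)%N; last first.
    by exists (fun=> 0); split=> //; apply: negligible0.
  have [||nu [nu_negl nuP]] := correct (width c) (map (enc c) rows) i.
  - by rewrite all_map; apply/allP => x /cK[/= -> _].
  - by rewrite size_map.
  - by exists nu.
have /choice[nu nuP] (li : nat * nat) := fetch_error _ (lex_codec P li.1) (DB li.1) li.2.
have /choice[mu muP] := fetch_error _ (vec_codec P) (vec_table P).
(* Correctness gives a separate error for each row. The rows are finitely many and do not depend on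
   the query, so the sum is one negligible bound valid for every fetch. *)
pose positions := [seq (l, i) | l <- iota 1 (height P), i <- iota 0 (lex_rows P l)].
pose err lam := \sum_(li <- positions) `|nu li lam|
                + \sum_(i <- iota 0 (vec_rows P)) `|mu i lam|.
have err_negl : negligible err.
  by apply: negligibleD; apply: negligible_sum => i; apply: negligible_norm;
    [case: (nuP i)|case: (muP i)].
have ideal_lex lam l i : (0 < l <= height P)%N -> (i < lex_rows P l)%N ->
    ideal Pi lam (err lam) (fetch Pi lam l (lex_codec P l) (DB l) i)
      [:: (lex_endpoint P l, i)] (nth None (DB l) i).
  move=> lP il; rewrite /lex_endpoint -size_DB//; apply: ideal_fetch.
  - by case: (lexP l lP).
  - by rewrite size_DB.
  - have [_ /(_ (proj2 (lexP l lP)))] := nuP (l, i); rewrite /= size_DB// => /(_ il lam).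
    apply: le_trans; rewrite lerD2l lerN2 /err.
    apply: le_trans (ler_norm _) _; rewrite (big_rem (l, i)) /=.
      rewrite -addrA lerDl addr_ge0// sumr_ge0//.
    by apply/allpairsPdep; exists l, i; rewrite !mem_iota; split => //; lia.
have ideal_vec lam i : (i < vec_rows P)%N ->
    ideal Pi lam (err lam) (fetch Pi lam (height P).+1 (vec_codec P) (vec_table P) i)
      [:: (vec_endpoint P, i)] (nth [::] (vec_table P) i).
  move=> iv; rewrite /vec_endpoint -[in vec_rows P]size_vec; apply: ideal_fetch => //.
  - by rewrite size_vec.
  - have [_ /(_ vecP)] := muP i; rewrite size_vec => /(_ iv lam).
    apply: le_trans; rewrite lerD2l lerN2 /err.
    apply: le_trans (ler_norm _) _; rewrite [X in _ + X](big_rem i) /=.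
      by rewrite addrCA lerDl addr_ge0// sumr_ge0.
    by rewrite mem_iota.
have [hyb hyb_negl hybP] := hybrid D private (plan P) [::].
exists (fun lam => err lam *+ size (plan P) + hyb lam); split.
  by apply: negligibleD => //; apply: negligible_muln.
move=> lam Q.
have [rs [res [rs_ideal rsE rs_ok]]] :=
  ideal_pillar_tree wfP Q (ideal_lex lam) (ideal_vec lam).
have viewE : Pr_accept R D lam (server_view DB Pi lam Q) =
    Ex (fun vo => accepts R D lam vo.1) (pillar_tree DB Pi lam Q).
  by rewrite /Pr_accept /server_view bindA Pr_bind.
have simE : Pr_accept R D lam (output Sim [:: unary lam]) =
    Ex (accepts R D lam) (transcript Pi lam (idle (plan P))).
  by rewrite /Pr_accept SimE bindA Pr_bind.
(* The intermediate experiment is the transcript at the actual positions [rs]: correctness relates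
   it to the real view, privacy to the simulated one. *)
rewrite viewE simE; apply: le_trans (ler_distD _ _ _) (lerD _ (hybP lam rs rsE rs_ok)).
have := rs_ideal (fun vo => accepts R D lam vo.1) (fun vo => Pr_test R _ _).
by rewrite Ex_bind -rsE size_map.
Qed.
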